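(* Consider the classic bandit setting with $k=2$ arms in the partial information model, and the following payment scheme with parameter $\delta\in(0,1)$. In each round $t$, choose an arm $a^t\in\{1,2\}$ uniformly at random, offer payment $$p(\delta,t,n_1^t,n_2^t)=\mathrm{CW}(\delta,t,n_1^t)+\mathrm{CW}(\delta,t,n_2^t),\qquad \mathrm{CW}(\delta,t,n)=2\sqrt{\frac{\ln\left(\frac{(\pi(t+1))^2}{3\delta}\right)}{n}},$$ for playing arm $a^t$, and offer payment $0$ for playing the other arm; whenever the agent selects the arm associated with zero payment, offer zero payment for both arms in all future rounds. Here $n_i^t$ is the number of times arm $i$ has been played before round $t$. Then this payment scheme is fair in every round with probability at least $1-\delta$. Moreover, the incurred total cost and expected regret are at most $\tilde O(\sqrt T)$.
   Context: Classic bandit setting. There are $k$ arms and $T$ rounds. An instance consists of, for each arm $j\in[k]$, a distribution $\mathcal F_j$ on $[0,1]$ with mean $\mu_j$, unknown to principal and agent. In each round $t$ the principal draws a payment vector $p^t\in\mathbb R_+^k$ from a distribution that may depend on the principal's information; $p^t_i$ is paid to the agent if it selects arm $i$. The myopic agent then selects $i^t\in M=\arg\max_i(\hat\mu^t_i+p^t_i)$, ties being broken uniformly at random among the members of $M$ with maximal payment $p^t_i$, and observes a reward $r^t_{i^t}\sim\mathcal F_{i^t}$. Here $\hat\mu^t_i$ is the empirical average of all rewards the agent has observed from arm $i$ before round $t$ (the agent is assumed to have at least one observation from every arm before the first round, so $n_i^t\ge1$). The total cost is $\sum_{t=1}^T p^t_{i^t}$. Information. The agent's history $h^t$ records, for rounds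 before $t$, the payments offered, the arms chosen and the realized rewards. In the partial information model the principal only observes the past offered payments and the arms chosen (not the rewards). Fairness. Let $\pi^t_{j|h}$ be the probability (over the principal's randomization in round $t$ and the agent's tie-breaking) that arm $j$ is selected in round $t$ given history $h^t$. The scheme is fair in round $t$ (given $h^t$) if for all $j,j'\in[k]$, $\pi^t_{j|h}>\pi^t_{j'|h}$ only if $\mu_j>\mu_{j'}$. ''Fair in every round with probability at least $1-\delta$'' means that with probability at least $1-\delta$ over the realization of the history, the scheme is fair in every round $t\in[T]$. Regret. With $\pi^t$ the distribution of the selected arm in round $t$, regret is $\sum_{t}\max_j\mu_j-\mathbb E_{i^t\sim\pi^t}\left[\sum_t\mu_{i^t}\right]$. $\tilde O$ hides factors polylogarithmic in $T$ and $1/\delta$. In the definition of $\mathrm{CW}$, $\pi$ is the usual constant $3.14\ldots$.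
   Formalization: For fixed δ the unconditional expected regret can be linear in T, so the regret bound Õ(√T) is stated with probability at least 1−δ (jointly with fairness and the cost bound), and the unconditional expected regret is bounded by Õ(√T) + δT. *)

(* Defs.v *)
From HB Require Import structures.
From mathcomp Require Import all_boot all_order all_algebra.
From mathcomp Require Import all_classical all_reals all_analysis.

Set Implicit Arguments.
Unset Strict Implicit.
Unset Printing Implicit Defensive.

Import Order.TTheory GRing.Theory Num.Theory.

Local Open Scope classical_set_scope.
Local Open Scope ring_scope.

(* The k = 2 arms; [~~ i] is the arm other than [i]. *)
Definition arm : Type := bool.

Section Bandit.
Context {R : realType}.

Definition payment : Type := arm -> R.

Record round := Round {
  offered : payment ;
  played : arm ;
  reward : R }.

(* The agent's history h^t: the t - 1 rounds before round t, oldest first. *)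
Definition history : Type := seq round.

(* The partial information model: the offered payments and the chosen arms,
   without the rewards. *)
Definition view : Type := seq (payment * arm).

Definition principal_view (h : history) : view :=
  [seq (offered r, played r) | r <- h].

(* A scheme whose only randomization is one arm drawn uniformly in each round;
   [scheme v a] is the payment vector offered after [v] when [a] is drawn. *)
Definition scheme : Type := view -> arm -> payment.

Section Agent.
(* the rewards the agent observed from each arm before the first round *)
Variable obs0 : arm -> seq R.

Definition observations (h : history) (i : arm) : seq R :=
  obs0 i ++ [seq reward r | r <- h & played r == i].

Definition empirical_mean (h : history) (i : arm) : R :=
  (\sum_(x <- observations h i) x) / (size (observations h i))%:R.

Definition myopic_best (h : history) (p : payment) : {set arm} :=
  [set i | [forall j, empirical_mean h j + p j <= empirical_mean h i + p i]].

Definition candidates (h : history) (p : payment) : {set arm} :=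
  [set i in myopic_best h p | [forall j in myopic_best h p, p j <= p i]].

(* With two arms, a uniform [c] makes [choose h p c] uniform on
   [candidates h p]. *)
Definition choose (h : history) (p : payment) (c : arm) : arm :=
  if c \in candidates h p then c else ~~ c.

Variable s : scheme.

(* pi^t_{j|h}: uniform draw of the principal's arm [a], then uniform choice of
   the agent among the candidates. *)
Definition sel_prob (h : history) (j : arm) : R :=
  \sum_(a : arm) 2^-1 *
    (let C := candidates h (s (principal_view h) a) in
     if j \in C then #|C|%:R^-1 else 0).

Definition fair (mu : arm -> R) (h : history) : Prop :=
  forall j j' : arm, sel_prob h j' < sel_prob h j -> mu j' < mu j.

(* The randomness of a round: the principal's arm [a], the agent's tie-breaking
   arm [c], and one reward for each arm, of which only that of the played arm is
   observed. *)
Definition noise : Type := (bool * bool * (R * R))%type.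

Definition play (h : history) (z : noise) : history :=
  let: (a, c, (x0, x1)) := z in
  let p := s (principal_view h) a in
  let i := choose h p c in
  rcons h (Round p i (if i then x1 else x0)).

(* the history after [t] rounds, i.e. h^{t+1} *)
Definition run (zs : seq noise) (t : nat) : history :=
  foldl play [::] (take t zs).

End Agent.

Definition CW (delta : R) (t n : nat) : R :=
  2 * Num.sqrt (ln ((pi * t.+1%:R) ^+ 2 / (3 * delta)) / n%:R).

Definition width_sum (delta : R) (t n1 n2 : nat) : R :=
  CW delta t n1 + CW delta t n2.

(* n_i^t counts the [m i] >= 1 plays made before the first round. *)
Definition plays (m : arm -> nat) (v : view) (i : arm) : nat :=
  m i + count (fun x => x.2 == i) v.

(* The width is positive, so a paid arm never counts as a zero-payment arm;
   once stopped, all payments are 0 and [stopped] stays true. *)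
Definition stopped (v : view) : bool := has (fun x => x.1 x.2 == 0) v.

Definition CW_scheme (delta : R) (m : arm -> nat) : scheme := fun v a i =>
  if ~~ stopped v && (i == a)
  then width_sum delta (size v).+1 (plays m v false) (plays m v true)
  else 0.

Section Iid.
Context {d : measure_display} {T : measurableType d}.

Definition tuple_cons (n : nat) (x : T * n.-tuple T) : n.+1.-tuple T :=
  [tuple of x.1 :: x.2].

Lemma measurable_tuple_cons n : measurable_fun setT (@tuple_cons n).
Proof. exact: measurable_cons measurable_fst measurable_snd. Qed.

HB.instance Definition _ n :=
  isMeasurableFun.Build _ _ _ _ (@tuple_cons n) (@measurable_tuple_cons n).

Fixpoint iid (P : probability T R) (n : nat) : probability (n.-tuple T) R :=
  match n with
  | 0 => \d_([tuple] : 0.-tuple T)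
  | n'.+1 => distribution (P \x iid P n')%E (@tuple_cons n')
  end.

End Iid.

Section Instance.
Variables (F : arm -> probability R R) (m : arm -> nat).

Definition mean (i : arm) : R := \int[F i]_x x.

Definition best_mean : R := Num.max (mean false) (mean true).

Variables (delta : R) (T : nat).

(* An outcome: the agent's initial observations of the two arms, followed by
   the noise of the T rounds. *)
Definition outcome : Type :=
  ((m false).-tuple R * (m true).-tuple R * T.-tuple noise)%type.

Definition law : probability outcome R :=
  ((iid (F false) (m false) \x iid (F true) (m true)) \x
   iid ((bernoulli_prob 2^-1 \x bernoulli_prob 2^-1) \x (F false \x F true)) T)%E.

Definition initial_obs (w : outcome) (i : arm) : seq R :=
  if i then w.1.2 : seq R else w.1.1 : seq R.

Definition hist (w : outcome) (t : nat) : history :=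
  run (initial_obs w) (CW_scheme delta m) w.2 t.

Definition fair_in_every_round (w : outcome) : Prop :=
  forall t : nat, (t < T)%N ->
    fair (initial_obs w) (CW_scheme delta m) mean (hist w t).

Definition total_cost (w : outcome) : R :=
  \sum_(r <- hist w T) offered r (played r).

(* The regret given the histories; the expected regret is its mean under
   [law]. *)
Definition regret (w : outcome) : R :=
  \sum_(t < T) (best_mean - \sum_(i : arm)
    sel_prob (initial_obs w) (CW_scheme delta m) (hist w t) i * mean i).

End Instance.

(* The shape of an O~(sqrt T) bound, where O~ hides factors polylogarithmic in T
   and 1 / delta. *)
Definition sqrt_polylog (C : R) (a b : nat) (T : nat) (delta : R) : R :=
  C * Num.sqrt T%:R * (1 + ln T%:R) ^+ a * (1 + ln delta^-1) ^+ b.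

End Bandit.

Arguments law {R} F m T.
Arguments fair_in_every_round {R} F m delta T w.
Arguments total_cost {R} m delta T w.
Arguments regret {R} F m delta T w.

(* Main.v *)
(* Before stopping, a paid arm is played unless the empirical mean of the other
   arm b leads by more than the sum of the two confidence widths.  If every
   empirical mean stays within half a width of its expectation, such a lead
   forces b to be the better arm, and b keeps the lead forever, so that
   from then on b is played for free; until then either both arms are equally
   likely or only b is played.  Hence fairness, and both the cost and the regret
   are bounded by the sum of the payments on offer before stopping.  Each arm is
   drawn about t/2 times in t rounds before stopping, so these payments decay
   like 1/sqrt t and sum to O~(sqrt T).

   Both deviation bounds come from Ville's maximal inequality: for the
   exponential supermartingale of the rewards of an arm along the adaptively
   generated history, and for that of the number of draws of an arm. *)
Require Import Defs.
From mathcomp Require Import all_boot all_order all_algebra.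
From mathcomp Require Import all_classical all_reals all_analysis.
From mathcomp Require Import measurable_realfun.
From mathcomp Require Import ring lra zify.

Set Implicit Arguments.
Unset Strict Implicit.
Unset Printing Implicit Defensive.

Import Order.TTheory GRing.Theory Num.Theory.
Import numFieldNormedType.Exports.

Local Open Scope classical_set_scope.
Local Open Scope ring_scope.

(** * Hoeffding's lemma *)

(** An arm is observed at adaptively chosen rounds, so its rewards are not a sum over a fixed number
    of independent variables. The supermartingale is therefore followed along the game itself, one
    noise at a time, starting from the initial observations. Failure is split into two unequal
    events. The event on rewards has probability at most [9 / 16 * delta]: half a width is the
    Hoeffding radius at level [expR (- (2 * logw delta k))], which is of order [k ^- 4] and hence
    summable. The event on draws suffices for the cost, because nothing is paid after stopping,
    whether or not the stop was right. It is given probability only [delta / (4 * T)], at the price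
    of a larger logarithm; the factor [1 / T] offsets the up to [T] rounds of full payment on that
    event, so the expected cost keeps no term linear in [T]. *)

Lemma is_derive_ge0_le (R : realType) (f df : R -> R) (x : R) :
  (forall y : R, is_derive y 1 f (df y)) -> (forall y, 0 <= y -> 0 <= df y) ->
  0 <= x -> f 0 <= f x.
Proof.
move=> fdf df0 x0.
have fc : {within `[0, x], continuous f}.
  apply: continuous_subspaceT => y.
  apply: differentiable_continuous; apply/derivable1_diffP.
  by case: (fdf y).
have [c] := MVT_segment x0 (fun y _ => fdf y) fc.
rewrite in_itv /= subr0 => /andP[c0 _] fE.
by rewrite -subr_ge0 fE mulr_ge0 // df0.
Qed.

Section HoeffdingLemma.
Context {R : realType}.
Implicit Types mu x : R.

Let w mu x : R := 1 - mu + mu * expR x.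

Let w_gt0 mu x : 0 <= mu <= 1 -> 0 < w mu x.
Proof.
rewrite /w => /andP[mu0 mu1]; have := expR_gt0 x => e0.
have [->|] := eqVneq mu 0; first by rewrite subr0 mul0r addr0.
move=> muN0; have mup : 0 < mu by rewrite lt_def muN0.
by rewrite ltr_wpDl ?mulr_gt0 // subr_ge0.
Qed.

Let w_derive mu x : is_derive x 1 (w mu) (mu * expR x).
Proof.
apply: (@is_derive_eq _ _ _ (cst (1 - mu) + (mu \*: expR)) x 1 _ (0 + mu *: expR x)).
by rewrite add0r.
Qed.

(** The logarithmic gap [g] vanishes at 0 together with its derivative [h], and [dh] is
    [1/4 - q (1 - q)] for [q = mu * expR y / w mu y], which is nonnegative because the numerator of
    the difference is a square. *)
Let hoeffding_mgf_ge0 mu x : 0 <= mu <= 1 -> 0 <= x ->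
  w mu x <= expR (x * mu + x ^+ 2 / 8).
Proof.
move=> mu01 x0; have wp y := w_gt0 y mu01.
pose g y : R := y * mu + y ^+ 2 / 8 - ln (w mu y).
pose h y : R := y / 4 + mu - 1 + (1 - mu) * (w mu y)^-1.
have gh (y : R) : is_derive y 1 g (h y).
  have H := is_derive1_ln (wp y).
  have H2 := @is_derive1_comp R (@ln R) (w mu) y _ _ H (w_derive mu y).
  have -> : g = (mu \*: id) + (8^-1 \*: (fun z : R => z ^+ 2)) - (@ln R \o w mu).
    apply/funext => z; rewrite /g !fctE /= /GRing.scale /=; ring.
  apply: is_derive_eq; rewrite /h /= /GRing.scale /=.

  have -> : mu * expR y = w mu y - (1 - mu) by rewrite /w; ring.
  by field; rewrite gt_eqF.
pose dh y : R := 4^-1 - (1 - mu) * mu * expR y / (w mu y) ^+ 2.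
have hdh (y : R) : is_derive y 1 h (dh y).
  have wN0 : w mu y != 0 by rewrite gt_eqF.
  have H := is_deriveV wN0 (w_derive mu y).
  have -> : h = (4^-1 \*: id) + cst (mu - 1) + ((1 - mu) \*: (fun z => (w mu z)^-1)).
    by apply/funext => z; rewrite /h !fctE /= /GRing.scale /=; ring.
  apply: is_derive_eq; rewrite /dh /= /GRing.scale /=;
  by field.
have dh0 y : 0 <= y -> 0 <= dh y.
  move=> _; rewrite /dh subr_ge0 ler_pdivrMr ?exprn_gt0 //.
  rewrite ler_pdivlMl // -subr_ge0 /w.
  rewrite (_ : _ - _ = (1 - mu - mu * expR y) ^+ 2) ?sqr_ge0 //; ring.
have h0 y : 0 <= y -> 0 <= h y.
  move=> y0; apply: le_trans (is_derive_ge0_le hdh dh0 y0).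
  by rewrite /h /w expR0 mulr1 subrK invr1; lra.
have := is_derive_ge0_le gh h0 x0.
rewrite /g [in w mu 0]/w expR0 mulr1 subrK ln1 mul0r expr0n /= mul0r addr0 subr0.
rewrite subr_ge0 => lnw.
by rewrite -[w mu x]lnK ?ler_expR // posrE.
Qed.

(** The left side is the moment generating function of a Bernoulli variable. Exchanging its two
    outcomes replaces [mu] by [1 - mu] and [x] by [- x], up to the factor [expR x], which reduces
    negative [x] to positive. *)
Lemma hoeffding_mgf mu x : 0 <= mu <= 1 ->
  1 - mu + mu * expR x <= expR (x * mu + x ^+ 2 / 8).
Proof.
move=> mu01; have [x0|x0] := leP 0 x; first exact: hoeffding_mgf_ge0.
have Nx0 : 0 <= - x by rewrite oppr_ge0 ltW.
have Nmu01 : 0 <= 1 - mu <= 1 by lra.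
have := hoeffding_mgf_ge0 Nmu01 Nx0; rewrite /w => H.
have -> : x * mu + x ^+ 2 / 8 = x + (- x * (1 - mu) + (- x) ^+ 2 / 8) by ring.
rewrite expRD; have -> : 1 - mu + mu * expR x =
    expR x * (1 - (1 - mu) + (1 - mu) * expR (- x)).
  by rewrite expRN; field; rewrite expR_eq0.
by rewrite ler_pM2l ?expR_gt0.
Qed.

End HoeffdingLemma.

(** * Ville's inequality and product integrals *)

(** Obtained from the definition of the integral as a supremum over simple functions, so that it
    applies to functions of unknown measurability, such as the measures of sections in [ville] and
    [law_le]. *)
Lemma ge0_le_integralT (d : measure_display) (T : measurableType d)
    (R : realType) (mu : {measure set T -> \bar R}) (f g : T -> \bar R) :
  (forall x, 0 <= f x)%E -> (forall x, f x <= g x)%E ->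
  (\int[mu]_x f x <= \int[mu]_x g x)%E.
Proof.
move=> f0 fg; have g0 x : (0 <= g x)%E by exact: le_trans (f0 x) (fg x).
rewrite !ge0_integralTE //; apply: le_ereal_sup => _ [h hf <-]; exists h => //.
by move=> x /=; exact: le_trans (hf x) (fg x).
Qed.

(* The induction on [n] follows [iid] by its very definition, so that no
   measurability of the event is needed. *)
Lemma ville (d : measure_display) (T : measurableType d) (R : realType)
    (Q : probability T R) (S : Type) (step : S -> T -> S) (M : S -> R) :
  (forall h, 0 <= M h) ->
  (forall h, (\int[Q]_z (M (step h z))%:E <= (M h)%:E)%E) ->
  forall (n : nat) (h : S),
  (iid Q n [set zs : n.-tuple T | exists2 t : nat, (t <= n)%N &
     (1 <= M (foldl step h (take t zs)))%R] <= (M h)%:E)%E.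
Proof.
move=> M0 Mstep n; elim: n => [|n IHn] h; have [M1|M1] := leP 1 (M h).
- rewrite [X in iid Q 0 X](_ : _ = setT); first by rewrite probability_setT lee_fin.
  by apply/seteqP; split => // zs _; exists 0 => //=; rewrite take0.
- rewrite [X in iid Q 0 X](_ : _ = set0); first by rewrite measure0 lee_fin.
  apply/seteqP; split => // zs [t]; rewrite leqn0 => /eqP ->.
  by rewrite take0 /= leNgt M1.
- rewrite [X in iid Q n.+1 X](_ : _ = setT); first by rewrite probability_setT lee_fin.
  by apply/seteqP; split => // zs _; exists 0 => //=; rewrite take0.
(* As [M h < 1], time 0 is no crossing, so the section at a first noise [x] is the crossing event
   started from [step h x]. *)
- apply: le_trans (Mstep h).
  apply: ge0_le_integralT => [x|x]; first exact: measure_ge0.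
  apply: le_trans (IHn (step h x)).
  rewrite le_eqVlt; apply/orP; left; apply/eqP; congr (iid Q n _).
  apply/seteqP; split => zs; rewrite /xsection /= inE /=.
    move=> [[|t]] /=; first by rewrite leNgt M1.
    by rewrite ltnS => tn Mt; exists t.
  by move=> [t tn Mt]; exists t.+1.
Qed.

Lemma probability_integral_cst (d : measure_display) (T : measurableType d)
    (R : realType) (P : probability T R) (c : \bar R) :
  (\int[P]_x c = c)%E.
Proof. by rewrite integral_cst //= probability_setT mule1. Qed.

Section ProductIntegral.
Context (d1 d2 : measure_display) (T1 : measurableType d1)
  (T2 : measurableType d2) (R : realType).
Variables (P1 : probability T1 R) (P2 : probability T2 R).

Lemma prod_integral_le (f : (T1 * T2)%type -> \bar R) (c : \bar R) :
  measurable_fun [set: T1 * T2] f -> (forall z, 0 <= f z)%E ->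
  (forall x, \int[P2]_y f (x, y) <= c)%E -> (\int[P1 \x P2]_z f z <= c)%E.
Proof.
move=> mf f0 fc; rewrite fubini_tonelli1 // -[leRHS](probability_integral_cst P1).
by apply: ge0_le_integralT => // x; exact: integral_ge0.
Qed.

Lemma prod_integral_fst (f : T1 -> \bar R) :
  measurable_fun setT f -> (forall x, 0 <= f x)%E ->
  (\int[P1 \x P2]_z f z.1 = \int[P1]_x f x)%E.
Proof.
move=> mf f0; have mf1 : measurable_fun [set: T1 * T2] (f \o fst).
  exact: measurableT_comp mf measurable_fst.
rewrite (@fubini_tonelli1 _ _ _ _ _ P1 P2 _ mf1 (fun z => f0 z.1)).
by apply: eq_integral => x _; rewrite /fubini_F /= probability_integral_cst.
Qed.

Lemma prod_integral_snd (f : T2 -> \bar R) :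
  measurable_fun setT f -> (forall x, 0 <= f x)%E ->
  (\int[P1 \x P2]_z f z.2 = \int[P2]_x f x)%E.
Proof.
move=> mf f0; have mf2 : measurable_fun [set: T1 * T2] (f \o snd).
  exact: measurableT_comp mf measurable_snd.
rewrite (@fubini_tonelli1 _ _ _ _ _ P1 P2 _ mf2 (fun z => f0 z.2)).
by rewrite /fubini_F /= probability_integral_cst.
Qed.

End ProductIntegral.

(** Controls the starting value of the supermartingale of an arm, the product over its initial
    observations. *)
Lemma iid_integral_prod_le1 (d : measure_display) (T : measurableType d)
    (R : realType) (P : probability T R) (g : T -> R) (n : nat) :
  measurable_fun setT g -> (forall x, 0 <= g x) ->
  (\int[P]_x (g x)%:E <= 1)%E ->
  (\int[iid P n]_xs (\prod_(x <- xs) g x)%:E <= 1)%E.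
Proof.
move=> mg g0 g1.
have prod0 (s : seq T) : 0 <= \prod_(x <- s) g x by exact: prodr_ge0.
have mprod k : measurable_fun setT (fun xs : k.-tuple T => \prod_(x <- xs) g x).
  rewrite (_ : (fun _ => _) = (fun xs => \prod_(i < k) g (tnth xs i))); last first.
    by apply/funext => xs; rewrite big_tuple.
  apply: measurable_prod => i _; apply: measurableT_comp mg _.
  exact: measurable_tnth.
elim: n => [|n IHn].
  rewrite (@integral_dirac _ _ [tuple] R setT measurableT
    (fun xs => (\prod_(x <- xs) g x)%:E)).
    by rewrite diracT mul1e big_nil.
  apply/measurable_EFinP; exact: mprod.
rewrite /= ge0_integral_distribution //; last 2 first.
- apply/measurable_EFinP; exact: mprod.
- by move=> y; rewrite lee_fin.
rewrite fubini_tonelli1 //; last 2 first.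
- apply/measurable_EFinP; apply: (measurableT_comp (mprod n.+1)).
  exact: measurable_tuple_cons.
- by move=> y /=; rewrite lee_fin.
apply: le_trans g1; apply: ge0_le_integralT => x.
  by apply: integral_ge0 => y _ /=; rewrite lee_fin.
rewrite /fubini_F /= (eq_integral (fun xs : n.-tuple T =>
  ((g x)%:E * (\prod_(y <- xs) g y)%:E)%E)); last first.
  by move=> y _; rewrite /= big_cons EFinM.
rewrite ge0_integralZl //; last 3 first.
- apply/measurable_EFinP; exact: mprod.
- by move=> y _; rewrite lee_fin.
- by rewrite lee_fin.
by rewrite -[leRHS]mule1 lee_wpmul2l // lee_fin.
Qed.

(** * Exponential moments of a distribution on the unit interval *)

Section BoundedReward.
Context (R : realType) (P : probability R R).
Hypothesis P01 : P `[0, 1]%classic = 1%E.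

Let Pmean : R := \int[P]_x x.

(** Integrals against [P] run over the whole line; replacing [x] by [clip x] changes none of them
    and turns almost sure bounds into pointwise ones. *)
Let clip (x : R) : R := Num.min 1 (Num.max 0 x).

Let clip01 x : 0 <= clip x <= 1.
Proof.
by rewrite /clip le_min ler01 le_max lexx /= ge_min lexx.
Qed.

Let measurable_clip : measurable_fun [set: R] clip.
Proof. by apply: measurable_minr => //; exact: measurable_maxr. Qed.

Let integral_comp_clip (f : R -> \bar R) : measurable_fun setT f ->
  (\int[P]_x f x = \int[P]_x f (clip x))%E.
Proof.
have PC0 : P (~` `[0, 1]%classic) = 0 by rewrite probability_setC // P01 subee.
move=> mf; apply: ae_eq_integral => //; first exact: measurableT_comp.
exists (~` `[0, 1]%classic); split.
- exact: measurableC.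
- exact: PC0.
- move=> x /=; rewrite in_itv /= => /not_implyP[_ fx]; apply: contra_not fx => /andP[x0 x1].
  by rewrite /clip (max_idPr x0) (min_idPr x1).
Qed.

Let integral_clip : (\int[P]_x (clip x)%:E = Pmean%:E)%E.
Proof.
have meanE : Pmean = fine (\int[P]_x (clip x)%:E)%E.
  rewrite /Pmean /Rintegral.
  by rewrite (integral_comp_clip (f := EFin)).
rewrite meanE fineK // ge0_fin_numE; last first.
  by apply: integral_ge0 => x _; rewrite lee_fin; case/andP: (clip01 x).
apply: (@le_lt_trans _ _ 1%E); last exact: ltry.
rewrite -[leRHS](probability_integral_cst P); apply: ge0_le_integralT => x;
  by rewrite lee_fin; case/andP: (clip01 x).
Qed.

Lemma mean_01 : 0 <= Pmean <= 1.
Proof.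
rewrite -!lee_fin -integral_clip; apply/andP; split.
  by apply: integral_ge0 => x _; rewrite lee_fin; case/andP: (clip01 x).
rewrite -[leRHS](probability_integral_cst P); apply: ge0_le_integralT => x;
  by rewrite lee_fin; case/andP: (clip01 x).
Qed.

(** By convexity the exponential lies below its chord over the unit interval, which leaves the
    Bernoulli moment of [hoeffding_mgf]. The compensator [l ^+ 2 / 8] makes this the one-step
    inequality of a supermartingale. *)
Lemma hoeffding_le1 (l : R) :
  (\int[P]_x (expR (l * (x - Pmean) - l ^+ 2 / 8))%:E <= 1)%E.
Proof.
have mexp : measurable_fun setT (fun x : R => (expR (l * (x - Pmean) - l ^+ 2 / 8))%:E).
  apply/measurable_EFinP; apply: measurableT_comp => //.
  apply: measurable_funB => //; apply: measurable_funM => //.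
  exact: measurable_funB.
rewrite (integral_comp_clip mexp).
pose c := expR (- (l * Pmean + l ^+ 2 / 8)).
have c0 : 0 <= c by exact: expR_ge0.
have convex x : expR (l * (clip x - Pmean) - l ^+ 2 / 8) <=
    (1 - clip x) * c + clip x * (expR l * c).
  set y := clip x; have /andP[y0 y1] : 0 <= y <= 1 by exact: clip01.
  have -> : l * (y - Pmean) - l ^+ 2 / 8 = l * y - (l * Pmean + l ^+ 2 / 8) by ring.
  rewrite expRD -/c mulrA -mulrDl; apply: ler_wpM2r => //.
  (* The chord bound comes from the tangent of [expR] at [l * y], evaluated at 0 and at [l] and
     averaged with weights [1 - y] and [y]. *)
  have E0 : expR (l * y) * (1 - l * y) <= 1.
    rewrite -[leRHS](expRxMexpNx_1 (l * y)) ler_pM2l ?expR_gt0 //.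
    by have := expR_ge1Dx (- (l * y)).
  have E1 : expR (l * y) * (1 + (l - l * y)) <= expR l.
    rewrite -[in leRHS](subrKC (l * y) l) expRD ler_pM2l ?expR_gt0 //.
    exact: expR_ge1Dx.
  have := lerD (ler_wpM2l (_ : 0 <= 1 - y) E0) (ler_wpM2l y0 E1).
  rewrite subr_ge0 => /(_ y1); rewrite mulr1; apply: le_trans.
  by rewrite le_eqVlt; apply/orP; left; apply/eqP; ring.
apply: (@le_trans _ _
  (\int[P]_x ((1 - clip x) * c + clip x * (expR l * c))%:E)%E).
  by apply: ge0_le_integralT => x; rewrite lee_fin // expR_ge0.
have m1 : measurable_fun [set: R] (fun x => 1 - clip x) by exact: measurable_funB.
have int1 : (\int[P]_x (1 - clip x)%:E = (1 - Pmean)%:E)%E.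
  have : (\int[P]_x ((1 - clip x)%:E + (clip x)%:E) = 1)%E.
    rewrite -[RHS](probability_integral_cst P); apply: eq_integral => x _.
    by rewrite -EFinD subrK.
  rewrite ge0_integralD //; last 4 first.
  - by move=> x _; rewrite lee_fin subr_ge0; case/andP: (clip01 x).
  - by apply/measurable_EFinP; exact: m1.
  - by move=> x _; rewrite lee_fin; case/andP: (clip01 x).
  - by apply/measurable_EFinP; exact: measurable_clip.
  by rewrite integral_clip => E; rewrite EFinB -[X in (X - _)%E]E addeK.
under eq_integral do rewrite EFinD 2!EFinM.
rewrite ge0_integralD //; last 4 first.
- by move=> x _; rewrite -EFinM lee_fin mulr_ge0 // subr_ge0; case/andP: (clip01 x).
- by apply/measurable_EFinP; apply: measurable_funM.
- by move=> x _; rewrite -EFinM lee_fin mulr_ge0 ?mulr_ge0 ?expR_ge0 //; case/andP: (clip01 x).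
- by apply/measurable_EFinP; apply: measurable_funM.
rewrite !ge0_integralZr //; last 5 first.
- by apply/measurable_EFinP; exact: measurable_clip.
- by move=> x _; rewrite lee_fin; case/andP: (clip01 x).
- by rewrite lee_fin mulr_ge0 ?expR_ge0.
- by apply/measurable_EFinP; exact: m1.
- by move=> x _; rewrite lee_fin subr_ge0; case/andP: (clip01 x).
rewrite int1 integral_clip -!EFinM -EFinD lee_fin mulrA -mulrDl.
rewrite /c expRN ler_pdivrMr ?expR_gt0 // mul1r.
exact: hoeffding_mgf mean_01.
Qed.

End BoundedReward.

(** * One round of the game *)

Lemma negb_eqF (b : arm) : ((~~ b == b) = false) * ((b == ~~ b) = false).
Proof. by case: b. Qed.

Section Candidates.
Context (R : realType) (obs0 : arm -> seq R).
Implicit Types (h : @history R) (p : @payment R) (b : arm).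

Definition best (e : arm -> R) (p : @payment R) (i : arm) : bool :=
  e (~~ i) + p (~~ i) <= e i + p i.

(** The candidates depend on the real-valued history only through two comparisons; this form
    isolates them for the measurability argument. *)
Definition candidates_of (b : arm -> bool) (p : @payment R) : {set arm} :=
  finset (fun i => b i && (b (~~ i) ==> (p (~~ i) <= p i))).

Lemma candidates_ofE h p :
  candidates obs0 h p = candidates_of (best (empirical_mean obs0 h) p) p.
Proof.
have bestE i : (i \in myopic_best obs0 h p) = best (empirical_mean obs0 h) p i.
  rewrite inE; apply/forallP/idP => [/(_ (~~ i)) //|le_i j].
  have [->//|ji] := eqVneq j i.
  by have -> : j = ~~ i by case: (j) (i) ji => -[].
apply/finset.setP => i; rewrite finset.in_set [RHS]finset.in_set -!bestE; congr (_ && _).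
apply/forallP/implyP => [/(_ (~~ i)) /implyP|le_i j]; first by rewrite bestE.
apply/implyP; have [->//|ji] := eqVneq j i.
by have -> : j = ~~ i by case: (j) (i) ji => -[].
Qed.

Lemma candidates_better h p b :
  empirical_mean obs0 h (~~ b) + p (~~ b) < empirical_mean obs0 h b + p b ->
  candidates obs0 h p =i pred1 b.
Proof.
move=> lt_b i; rewrite candidates_ofE finset.in_set /best inE.
by case: b i lt_b => -[] /= lt_b; rewrite ?(ltW lt_b) leNgt lt_b.
Qed.

Lemma candidates_paid h p b :
  empirical_mean obs0 h (~~ b) + p (~~ b) <= empirical_mean obs0 h b + p b ->
  p (~~ b) < p b ->
  candidates obs0 h p =i pred1 b.
Proof.
move=> le_b lt_p i; rewrite candidates_ofE finset.in_set /best inE.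
by case: b i le_b lt_p => -[] /= le_b lt_p;
  rewrite le_b ?(ltW lt_p) ?implybT //= [p _ <= p _]leNgt lt_p andbF.
Qed.

Lemma choose_pred1 h p b c :
  candidates obs0 h p =i pred1 b -> Defs.choose obs0 h p c = b.
Proof. by move=> Cb; rewrite /Defs.choose Cb inE; case: c b {Cb} => -[]. Qed.

Lemma sel_prob_pred1 (s : scheme) h (f : arm -> arm) (j : arm) :
  (forall a, candidates obs0 h (s (principal_view h) a) =i pred1 (f a)) ->
  sel_prob obs0 s h j = 2^-1 * (j == f true)%:R + 2^-1 * (j == f false)%:R.
Proof.
move=> Cf; rewrite /sel_prob big_bool !Cf !inE.
by congr (2^-1 * _ + 2^-1 * _); rewrite (fintype.eq_card1 (Cf _)) invr1; case: (j == _).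
Qed.

Lemma sel_prob_ge0 (s : scheme) h (j : arm) : 0 <= sel_prob obs0 s h j.
Proof.
apply: sumr_ge0 => a _; apply: mulr_ge0 => //=.
by case: ifP => // _; rewrite invr_ge0.
Qed.

Lemma sum_sel_prob (s : scheme) h : \sum_(i : arm) sel_prob obs0 s h i = 1.
Proof.
have H (C : {set arm}) : (exists i, i \in C) ->
    \sum_(j : arm) (if j \in C then #|C|%:R^-1 else 0) = 1 :> R.
  move=> [i iC]; rewrite -big_mkcond sumr_const -[_ *+ _]mulr_natl divff //.
  by rewrite pnatr_eq0 -lt0n; apply/card_gt0P; exists i.
have cand_ex p : exists i, i \in candidates obs0 h p.
  pose e (i : arm) := empirical_mean obs0 h i + p i.
  have [lt_e|lt_e|eq_e] := ltgtP (e true) (e false).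
  - by exists false; rewrite (candidates_better (b := false)) ?inE.
  - by exists true; rewrite (candidates_better (b := true)) ?inE.
  - have [le_p|lt_p] := leP (p true) (p false); last first.
      by exists true; rewrite (candidates_paid (b := true)) ?inE //= -/(e false) -/(e true) eq_e.
    exists false; rewrite !inE; apply/andP; split; apply/forallP => -[].
    + by rewrite -/(e false) -/(e true) eq_e.
    + by [].
    + by apply/implyP.
    + exact/implyP.
rewrite /sel_prob exchange_big /=.
under eq_bigr do rewrite -mulr_sumr H // mulr1.
by rewrite big_bool /=; lra.
Qed.

End Candidates.

(** * Deterministic analysis of a path *)

Section LogWidth.
Context (R : realType) (delta : R).
Hypothesis delta01 : 0 < delta < 1.

(** The logarithm in the width of round [k.+1], that is after [k] completed rounds, hence [k.+2]. *)
Definition logw (k : nat) : R := ln ((pi * k.+2%:R) ^+ 2 / (3 * delta)).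

Lemma logw_arg_gt1 k : 1 < (pi * k.+2%:R) ^+ 2 / (3 * delta).
Proof.
have /andP[d0 d1] := delta01.
rewrite ltr_pdivlMr ?mulr_gt0 // mul1r.
have pi2 := @pi_ge2 R; have k2 : 2 <= k.+2%:R :> R by rewrite ler_nat.
have : 4 <= pi * k.+2%:R :> R by nra.
nra.
Qed.

Lemma logw_gt0 k : 0 < logw k.
Proof. by rewrite ln_gt0 // logw_arg_gt1. Qed.

Lemma logw_le k k' : (k <= k')%N -> logw k <= logw k'.
Proof.
move=> kk'; have /andP[d0 d1] := delta01.
rewrite ler_ln ?posrE ?(lt_trans ltr01 (logw_arg_gt1 _)) //.
rewrite ler_pM2r ?invr_gt0 ?mulr_gt0 // ler_sqr ?nnegrE ?mulr_ge0 ?pi_ge0 //.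
by rewrite ler_pM2l ?pi_gt0 // ler_nat !ltnS.
Qed.

Lemma CWE k n : CW delta k.+1 n = 2 * Num.sqrt (logw k / n%:R).
Proof. by []. Qed.

Lemma width_sum_gt0 k n1 n2 : (0 < n1)%N -> (0 < n2)%N ->
  0 < width_sum delta k.+1 n1 n2.
Proof.
by move=> n1p n2p; rewrite /width_sum !CWE addr_gt0 // mulr_gt0 // sqrtr_gt0
  divr_gt0 ?logw_gt0 ?ltr0n.
Qed.

End LogWidth.

Section Path.
Context (R : realType) (obs0 : arm -> seq R) (m : arm -> nat) (delta : R).
Hypothesis size_obs0 : forall i, size (obs0 i) = m i.
Hypothesis m_gt0 : forall i, (0 < m i)%N.
Hypothesis delta01 : 0 < delta < 1.

Let s : scheme := CW_scheme delta m.

Lemma size_principal_view (h : @history R) : size (principal_view h) = size h.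
Proof. exact: size_map. Qed.

Lemma plays_view (h : @history R) i :
  plays m (principal_view h) i = size (observations obs0 h i).
Proof.
rewrite /plays /observations size_cat size_map size_filter size_obs0.
by rewrite count_map; congr (_ + _)%N; apply: eq_count.
Qed.

Definition pay (h : @history R) : R :=
  width_sum delta (size h).+1 (size (observations obs0 h false))
    (size (observations obs0 h true)).

Lemma size_observations_gt0 (h : @history R) i :
  (0 < size (observations obs0 h i))%N.
Proof. by rewrite size_cat size_obs0 addn_gt0 m_gt0. Qed.

Lemma pay_gt0 h : 0 < pay h.
Proof. by apply: width_sum_gt0 => //; exact: size_observations_gt0. Qed.

Lemma schemeE h a i : s (principal_view h) a i =
  if ~~ stopped (principal_view h) && (i == a) then pay h else 0.
Proof. by rewrite /s /CW_scheme !plays_view size_principal_view. Qed.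

Lemma stopped_rcons (h : @history R) r :
  stopped (principal_view (rcons h r)) =
  (offered r (played r) == 0) || stopped (principal_view h).
Proof.
by rewrite /stopped /principal_view map_rcons has_rcons.
Qed.

Lemma observations_rcons (h : @history R) r i :
  observations obs0 (rcons h r) i =
  if played r == i then rcons (observations obs0 h i) (reward r)
  else observations obs0 h i.
Proof.
rewrite /observations filter_rcons; case: ifP => // _.
by rewrite map_rcons rcons_cat.
Qed.

Variable zs : seq (@noise R).
Notation h := (run obs0 s zs).
Notation n t i := (size (observations obs0 (h t) i)).
Notation emp t i := (empirical_mean obs0 (h t) i).
Notation stop t := (stopped (principal_view (h t))).

Definition draw (t : nat) : bool := (nth (false, false, (0, 0)) zs t).1.1.

(** Of the noise, the analysis of a path uses only the principal's draw; tie-breaking and rewards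
    stay abstract. *)
Lemma runS t : (t < size zs)%N ->
  exists p c x0 x1, [/\ p = s (principal_view (h t)) (draw t) &
  h t.+1 = rcons (h t) (Round p (Defs.choose obs0 (h t) p c)
             (if Defs.choose obs0 (h t) p c then x1 else x0))].
Proof.
move=> tz; rewrite /run (take_nth (false, false, (0, 0))) // foldl_rcons -/(run _ _ _ _).
rewrite /draw; case: (nth _ zs t) => -[a c] [x0 x1] /=.
by exists (s (principal_view (h t)) a), c, x0, x1.
Qed.

Lemma size_run t : (t <= size zs)%N -> size (h t) = t.
Proof.
elim: t => [|t IHt] tz; first by rewrite /run take0.
have [p [c [x0 [x1 [_ ->]]]]] := runS tz.
by rewrite size_rcons IHt // ltnW.
Qed.

Lemma size_observations_le t t' i : (t <= t')%N -> (t' <= size zs)%N ->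
  (n t i <= n t' i <= n t i + (t' - t))%N.
Proof.
move=> /subnK <-; elim: (t' - t)%N => [|k IHk]; first by rewrite add0n subnn addn0 leqnn.
rewrite addSn => kz; have {IHk} := IHk (ltnW kz).
have [p [c [x0 [x1 [_ ->]]]]] := runS kz.
rewrite observations_rcons subSn ?leq_addl // addnK.
by case: ifP => _; rewrite ?size_rcons; lia.
Qed.

(* A line in the current number [n t i] of observations, anchored at
   [m i + k]: there it equals [sqrt (L n)], and divided by any larger [n'] it is
   at most [sqrt (L / n)].  So one crossing event confines the empirical mean
   from [n] observations on, with the logarithm frozen at [k].  A union bound
   over later rounds would let the logarithm grow, which [n] cannot absorb when
   [m i] is large. *)
Definition good (mu : arm -> R) : Prop := forall (i : arm) (k t : nat),
  (k < size zs)%N -> (t <= size zs)%N ->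
  `|\sum_(x <- observations obs0 (h t) i) (x - mu i)| <
  2^-1 * Num.sqrt (logw delta k / (m i + k)%:R) * ((m i + k)%:R + (n t i)%:R).

Section Good.
Variable mu : arm -> R.
Hypothesis good_mu : good mu.

Lemma good_dev t t' i : (t <= t')%N -> (t' <= size zs)%N -> (t < size zs)%N ->
  `|emp t' i - mu i| < CW delta t.+1 (n t i) / 2.
Proof.
move=> tt' t'z tz; have n0 := size_observations_gt0 (h t) i.
have n'0 : (0 : R) < (n t' i)%:R by rewrite ltr0n size_observations_gt0.
have /andP[mn nm] : (m i <= n t i <= m i + t)%N.
  have := size_observations_le i (leq0n t) (ltnW tz).
  by rewrite [h 0]/run take0 /= /observations /= cats0 size_obs0 subn0.
have nE : (m i + (n t i - m i) = n t i)%N by rewrite subnKC.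
have kt : (n t i - m i <= t)%N by rewrite leq_subLR.
have := good_mu i (leq_ltn_trans kt tz) t'z.
rewrite sumrB big_const_seq count_predT iter_addr addr0 nE CWE.
rewrite [2 * Num.sqrt _]mulrC mulfK ?pnatr_eq0 //.
have -> : emp t' i - mu i =
    (\sum_(x <- observations obs0 (h t') i) x - mu i *+ n t' i) / (n t' i)%:R.
  by rewrite /empirical_mean mulrBl -[mu i *+ _]mulr_natr mulfK // gt_eqF.
move=> Z; rewrite normrM normfV (ger0_norm (ltW n'0)) ltr_pdivrMr //.
apply: lt_le_trans Z _.
apply: (@le_trans _ _ (Num.sqrt (logw delta (n t i - m i) / (n t i)%:R) * (n t' i)%:R)).
  rewrite [2^-1 * _]mulrC -mulrA ler_wpM2l ?sqrtr_ge0 // ler_pdivrMl // mulr_natl mulr2n.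
  by rewrite lerD2r ler_nat; case/andP: (size_observations_le i tt' t'z).
apply: ler_wpM2r; first exact: ltW.
by rewrite ler_wsqrtr // ler_wpM2r ?invr_ge0 ?ler0n // logw_le.
Qed.

Lemma payE t : (t <= size zs)%N ->
  pay (h t) = CW delta t.+1 (n t false) + CW delta t.+1 (n t true).
Proof. by move=> tz; rewrite /pay /width_sum size_run. Qed.

(** Since [t0] the mean of [~~ b] has not changed, and that of [b] has moved by less than its full
    width at [t0], as both values lie within half of that width of [mu b]. A lead exceeding both
    widths survives this. Half-widths at [t0] alone order the true means. *)
Lemma after_stop t t0 b : (t0 < t)%N -> (t <= size zs)%N ->
  emp t0 (~~ b) + pay (h t0) < emp t0 b ->
  observations obs0 (h t) (~~ b) = observations obs0 (h t0) (~~ b) ->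
  emp t (~~ b) < emp t b /\ mu (~~ b) < mu b.
Proof.
move=> t0t tz lt0 eq_obs; have t0z := leq_trans t0t tz.
have -> : emp t (~~ b) = emp t0 (~~ b) by rewrite /empirical_mean eq_obs.
have := good_dev (t := t0) (t' := t) b (ltnW t0t) tz t0z.
have := good_dev (t := t0) (t' := t0) b (leqnn _) (ltnW t0z) t0z.
have := good_dev (t := t0) (t' := t0) (~~ b) (leqnn _) (ltnW t0z) t0z.
move: lt0; rewrite (payE (ltnW t0z)).
rewrite !ltr_norml.
by case: b {eq_obs} => /= ? /andP[? ?] /andP[? ?] /andP[? ?]; split; lra.
Qed.

(** The witness [t0] is the round in which the arm [b] was first chosen without payment. From then
    on payments vanish and [after_stop] makes [b] the strict maximizer, so [~~ b] gains no
    observation and the invariant carries over. *)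
Lemma stop_inv t : (t <= size zs)%N -> stop t -> exists b t0,
  [/\ (t0 < t)%N, emp t0 (~~ b) + pay (h t0) < emp t0 b &
      observations obs0 (h t) (~~ b) = observations obs0 (h t0) (~~ b)].
Proof.
elim: t => [|t IHt] tz; first by rewrite /run take0.
have [p [c [x0 [x1 [pE ->]]]]] := runS tz.
rewrite stopped_rcons /=; have [st _|nst] := boolP (stop t).
  have [b [t0 [t0t lt0 eq_obs]]] := IHt (ltnW tz) st.
  have [lt_emp _] := after_stop t0t (ltnW tz) lt0 eq_obs.
  have Cb : candidates obs0 (h t) p =i pred1 b.
    by apply: candidates_better; rewrite pE !schemeE st /= !addr0.
  exists b, t0; split=> //; first exact: ltnW.
  rewrite observations_rcons /= (choose_pred1 _ Cb) eq_obs.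
  by case: (b) => //=; case: eqP.
rewrite orbF => /eqP p0; set a := draw t in pE.
(* A weak inequality suffices for the paid arm, because ties go to the larger payment; it would then
   be played at a positive price, against [p0]. *)
have [le_a|lt_a] := leP (emp t (~~ a)) (emp t a + pay (h t)).
  have Ca : candidates obs0 (h t) p =i pred1 a.
    apply: candidates_paid; rewrite pE !schemeE nst eqxx negb_eqF /=.
      by rewrite addr0.
    exact: pay_gt0.
  by move: p0; rewrite (choose_pred1 _ Ca) pE schemeE nst eqxx => /eqP;
    rewrite gt_eqF // pay_gt0.
have Ca : candidates obs0 (h t) p =i pred1 (~~ a).
  apply: candidates_better; rewrite negbK pE !schemeE nst eqxx.
  by rewrite negb_eqF /= addr0.
exists (~~ a), t; rewrite negbK; split=> //.
by rewrite observations_rcons /= (choose_pred1 _ Ca) negb_eqF.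
Qed.

(** In the second case neither empirical lead exceeds [pay], and the two half-widths add [pay / 2],
    so the true gap is at most [3/2] of [pay]. A bound by twice [pay] is enough: each arm is then
    played with probability one half, and the regret of the round is half the gap. *)
Lemma round_cases t : (t < size zs)%N ->
  (exists2 b, mu (~~ b) < mu b &
     forall a, candidates obs0 (h t) (s (principal_view (h t)) a) =i pred1 b) \/
  [/\ ~~ stop t, `|mu true - mu false| <= 2 * pay (h t) &
     forall a, candidates obs0 (h t) (s (principal_view (h t)) a) =i pred1 a].
Proof.
move=> tz; have [st|nst] := boolP (stop t).
  left; have [b [t0 [t0t lt0 eq_obs]]] := stop_inv (ltnW tz) st.
  have [lt_emp lt_mu] := after_stop t0t (ltnW tz) lt0 eq_obs.
  exists b => // a; apply: candidates_better.
  by rewrite !schemeE st /= !addr0.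
have p0 := pay_gt0 (h t).
have dev := fun i => good_dev (t := t) (t' := t) i (leqnn _) (ltnW tz) tz.
have := dev false; have := dev true; rewrite !ltr_norml => /andP[? ?] /andP[? ?].
have payt := payE (ltnW tz).
have better a : emp t a + pay (h t) < emp t (~~ a) ->
  exists2 b, mu (~~ b) < mu b &
     forall a, candidates obs0 (h t) (s (principal_view (h t)) a) =i pred1 b.
  move=> lt_a; exists (~~ a) => [|a'].
    by case: a lt_a => /= lt_a; lra.
  apply: candidates_better; rewrite negbK !schemeE nst /=.
  by case: eqP; case: eqP => _ _; rewrite ?addr0; lra.
have [le_t|/better] := leP (emp t (~~ true)) (emp t true + pay (h t)); last by left.
have [le_f|/better] := leP (emp t (~~ false)) (emp t false + pay (h t)); last by left.
right; split=> //.
  by rewrite ler_norml; apply/andP; split; rewrite /= in le_t le_f; lra.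
move=> a; apply: candidates_paid; rewrite !schemeE nst eqxx negb_eqF //=.
by rewrite addr0; case: a.
Qed.

(* Dominates both the cost of a round and, on the good event, its regret. *)
Definition upay (h : @history R) : R :=
  if stopped (principal_view h) then 0 else pay h.

Lemma upay_ge0 h' : 0 <= upay h'.
Proof. by rewrite /upay; case: ifP => // _; exact/ltW/pay_gt0. Qed.

Lemma fair_good t : (t < size zs)%N -> fair obs0 s mu (h t).
Proof.
move=> tz j j'; have [[b lt_mu Cb]|[_ _ Ca]] := round_cases tz.
  rewrite !(sel_prob_pred1 _ Cb) -!mulrDr ltr_pM2l ?invr_gt0 //.
  have [->|jb] := eqVneq j b; last by case: (j' == b) => /= lt_sel; exfalso; lra.
  have [->|] := eqVneq j' b; first by rewrite ltxx.
  by case: b j' lt_mu {Cb} => -[].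
by rewrite !(sel_prob_pred1 _ Ca) -!mulrDr; case: j j' => -[] /=;
  rewrite ?addr0 ?add0r ltxx.
Qed.

Lemma regret_round_good t : (t < size zs)%N ->
  Num.max (mu false) (mu true) - \sum_(i : arm) sel_prob obs0 s (h t) i * mu i
  <= upay (h t).
Proof.
move=> tz; rewrite big_bool; have [[b lt_mu Cb]|[nst le_mu Ca]] := round_cases tz.
  rewrite !(sel_prob_pred1 _ Cb); apply: le_trans (upay_ge0 _).
  by case: b lt_mu {Cb} => /= lt_mu; case: (ltP (mu false) (mu true)) => ?; lra.
rewrite !(sel_prob_pred1 _ Ca) /upay (negbTE nst).
move: le_mu; rewrite ler_norml => /andP[? ?].
by case: (ltP (mu false) (mu true)) => ? /=; lra.
Qed.

End Good.

Lemma cost_le_upay t : (t <= size zs)%N ->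
  \sum_(r <- h t) offered r (played r) <= \sum_(k < t) upay (h k).
Proof.
elim: t => [|t IHt] tz; first by rewrite /run take0 big_nil big_ord0.
have [p [c [x0 [x1 [-> ->]]]]] := runS tz.
rewrite big_rcons big_ord_recr /=.
apply: lerD; first exact: IHt (ltnW tz).
rewrite schemeE /upay.
case: (stop t) => //=; case: ifP => // _; exact/ltW/pay_gt0.
Qed.

Lemma cost_ge0 t : (t <= size zs)%N ->
  0 <= \sum_(r <- h t) offered r (played r).
Proof.
elim: t => [|t IHt] tz; first by rewrite /run take0 big_nil.
have [p [c [x0 [x1 [-> ->]]]]] := runS tz.
rewrite big_rcons /= addr_ge0 ?(IHt (ltnW tz)) // schemeE.
by case: ifP => // _; exact/ltW/pay_gt0.
Qed.

(** Playing an arm other than the drawn one would stop the scheme, so until then plays are draws,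
    and the adaptive counts reduce to counts of independent coin tosses. *)
Lemma unstopped_plays t i : (t <= size zs)%N -> ~~ stop t ->
  n t i = (m i + count (fun z => z.1.1 == i) (take t zs))%N.
Proof.
elim: t => [|t IHt] tz.
  by rewrite /run take0 /= /observations /= cats0 size_obs0 addn0.
rewrite (take_nth (false, false, (0, 0))) // -cats1 count_cat /= addn0 -/(draw t).
have [p [c [x0 [x1 [-> ->]]]]] := runS tz; rewrite stopped_rcons negb_or /=.
set j := Defs.choose _ _ _ _; rewrite schemeE.
case/andP => + nst; rewrite nst /=.
have [-> _|] := eqVneq j (draw t); last by rewrite eqxx.
rewrite observations_rcons /= addnA -IHt //; last exact: ltnW.
by case: ifP; rewrite ?size_rcons ?addn1 ?addn0.
Qed.

(** Crude bound from [n >= 1], meant for the event of bad draws, whose probability is of order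
    [1 / T]. *)
Lemma upay_le t : (t < size zs)%N -> upay (h t) <= 4 * Num.sqrt (logw delta (size zs)).
Proof.
move=> tz; have CW_le i : CW delta t.+1 (n t i) <= 2 * Num.sqrt (logw delta (size zs)).
  rewrite CWE ler_pM2l // ler_wsqrtr //; apply: le_trans (logw_le delta01 (ltnW tz)).
  have n0 : 1 <= (n t i)%:R :> R by rewrite ler1n size_observations_gt0.
  by rewrite ler_pdivrMr ?(lt_le_trans ltr01 n0) // ler_peMr // ltW // logw_gt0.
have := CW_le false; have := CW_le true.
rewrite /upay; case: ifP => _; first by rewrite mulr_ge0.
by rewrite payE ?(ltnW tz) //; lra.
Qed.

Lemma upay_le_draws (l : R) t : 0 <= l -> (t < size zs)%N ->
  (forall i, t%:R / 4 - l <= (count (fun z => z.1.1 == i) (take t zs))%:R) ->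
  upay (h t) <= 8 * Num.sqrt (logw delta (size zs) * (1 + l)) *
    Num.sqrt (t.+1%:R^-1).
Proof.
move=> l0 tz Hd; have L0 := logw_gt0 delta01 (size zs).
rewrite /upay; case: ifPn => [_|nst]; first by rewrite !mulr_ge0.
have CW_le i : CW delta t.+1 (n t i) <=
    4 * (Num.sqrt (logw delta (size zs) * (1 + l)) * Num.sqrt (t.+1%:R^-1)).
  have n0 : 1 <= (n t i)%:R :> R by rewrite ler1n size_observations_gt0.
  have n0' := lt_le_trans ltr01 n0.
  have t1 : 0 < t.+1%:R :> R by rewrite ltr0n.
  (* The deficit [l] is absorbed by having at least one observation:
     [4 (1 + l) n >= 4 n + 4 l >= t + 4], by [n >= 1] and [n >= 1 + t / 4 - l]. *)
  have nt : t.+1%:R <= 4 * (1 + l) * (n t i)%:R.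
    have := Hd i; have m1 : 1 <= (m i)%:R :> R by rewrite ler1n.
    have nE : (n t i)%:R = (m i)%:R + (count (fun z => z.1.1 == i) (take t zs))%:R :> R.
      by rewrite (unstopped_plays _ (ltnW tz) nst) natrD.
    rewrite -[t.+1]addn1 natrD; nra.
  rewrite CWE -sqrtrM ?mulr_ge0 ?addr_ge0 ?(ltW L0) //.
  have -> : (4 : R) = 2 * Num.sqrt 4.
    by rewrite (_ : 4 = 2 ^+ 2) ?sqrtr_sqr ?ger0_norm //; ring.
  rewrite -mulrA ler_pM2l // -sqrtrM // ler_wsqrtr //.
  apply: (@le_trans _ _ (logw delta (size zs) / (n t i)%:R)).
    by rewrite ler_wpM2r ?invr_ge0 ?ler0n // logw_le // ltnW.
  have -> : 4 * (logw delta (size zs) * (1 + l) * t.+1%:R^-1) =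
      logw delta (size zs) * (4 * (1 + l) / t.+1%:R) by ring.
  by rewrite ler_pM2l // ler_pdivlMr // mulrC ler_pdivrMr.
rewrite payE ?(ltnW tz) // -mulrA; have := CW_le false; have := CW_le true; lra.
Qed.

End Path.

Lemma sum_invsqrt_le (R : realType) (n : nat) :
  \sum_(t < n) Num.sqrt (t.+1%:R^-1) <= 2 * Num.sqrt n%:R :> R.
Proof.
elim: n => [|n IHn]; first by rewrite big_ord0 mulr_ge0.
rewrite big_ord_recr /=; set a := Num.sqrt n%:R in IHn *; set b := Num.sqrt n.+1%:R.
have a0 : 0 <= a by exact: sqrtr_ge0.
have b0 : 0 < b by rewrite sqrtr_gt0 ltr0n.
have a2 : a ^+ 2 = n%:R by rewrite sqr_sqrtr.
have b2 : b ^+ 2 = n.+1%:R by rewrite sqr_sqrtr.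
rewrite sqrtrV // -/b; have := sqr_ge0 (b - a).
have : b ^+ 2 = a ^+ 2 + 1 by rewrite a2 b2 -natr1.
move=> ba sq; rewrite -lerBrDr in IHn *.
apply: le_trans IHn _.
(* As [b ^+ 2 - a ^+ 2 = 1], the product [2 * b * (b - a)] equals [1 + (b - a) ^+ 2]. *)
have : b^-1 <= 2 * (b - a).
  by rewrite -div1r ler_pdivrMr //; nra.
lra.
Qed.

(** * Measurability *)

(** The values, such as views containing payment functions, carry no sigma-algebra, so all preimages
    are required to be measurable. Views take finitely many values because payments are a function
    of past draws and choices; only the sums of rewards are genuinely real-valued. *)
Definition simple_rv (d : measure_display) (W : measurableType d) (X : Type)
    (f : W -> X) : Prop :=
  finite_set (range f) /\ forall A : set X, measurable (f @^-1` A).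

Section SimpleRv.
Context (d : measure_display) (W : measurableType d).

Lemma simple_rv_set (X : Type) (f : W -> X) (Q : X -> set W) :
  simple_rv f -> (forall x, measurable (Q x)) ->
  measurable [set w | Q (f w) w].
Proof.
move=> [finf mf] mQ.
rewrite (_ : [set w | _] = \bigcup_(x in range f) (f @^-1` [set x] `&` Q x)).
  by apply: fin_bigcup_measurable => // x _; apply: measurableI.
apply/seteqP; split => [w Qw|w [_ _ [/= <- //]]].
by exists (f w) => //; exists w.
Qed.

Lemma simple_rv_measurable (d' : measure_display) (U : measurableType d')
    (X : Type) (f : W -> X) (G : X -> W -> U) :
  simple_rv f -> (forall x, measurable_fun setT (G x)) ->
  measurable_fun setT (fun w => G (f w) w).
Proof.
move=> sf mG _ B mB; rewrite setTI.
apply: (simple_rv_set (Q := fun x => G x @^-1` B) sf) => x.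
by rewrite -[X in measurable X]setTI; exact: mG.
Qed.

Lemma simple_rv_comp (X Y : Type) (f : W -> X) (g : X -> Y) :
  simple_rv f -> simple_rv (g \o f).
Proof.
move=> [finf mf]; split => [|A]; last exact: mf (g @^-1` A).
by rewrite -(image_comp f g); exact: finite_image.
Qed.

Lemma simple_rv_pair (X Y : Type) (f : W -> X) (g : W -> Y) :
  simple_rv f -> simple_rv g -> simple_rv (fun w => (f w, g w)).
Proof.
move=> sf sg; split => [|A].
  apply: (@sub_finite_set _ _ (range f `*` range g)).
    by move=> _ [w _ <-]; split => /=; exists w.
  by apply: finite_setX; [exact: sf.1|exact: sg.1].
apply: (simple_rv_set (Q := fun x => g @^-1` [set y | A (x, y)]) sf) => x.
exact: sg.2.
Qed.

Lemma simple_rv_cst (X : Type) (x : X) : simple_rv (fun _ : W => x).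
Proof.
split => [|A]; first by apply: (@sub_finite_set _ _ [set x]) => // _ [_ _ <-].
by have [Ax|nAx] := pselect (A x);
  [rewrite (_ : _ @^-1` _ = setT)|rewrite (_ : _ @^-1` _ = set0)] => //;
  apply/seteqP; split.
Qed.

Lemma simple_rv_bool (f : W -> bool) : measurable_fun setT f -> simple_rv f.
Proof.
move=> mf; split => [|A]; first exact: finite_finset.
by rewrite -[X in measurable X]setTI; exact: mf.
Qed.

Lemma simple_rv_fun (d' : measure_display) (U : measurableType d') (f : W -> U) :
  simple_rv f -> measurable_fun setT f.
Proof. by move=> [_ mf] _ B _; rewrite setTI. Qed.

Lemma simple_rv_bool_family (X : Type) (f : W -> X) (G : X -> W -> bool) :
  simple_rv f -> (forall x, measurable_fun setT (G x)) ->
  simple_rv (fun w => G (f w) w).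
Proof. by move=> sf mG; apply: simple_rv_bool; exact: simple_rv_measurable. Qed.

End SimpleRv.

Section HistoryMeasurability.
Context (R : realType) (d : measure_display) (W : measurableType d).
Variables (m : arm -> nat) (s : @scheme R) (T : nat).
Variables (obs : W -> arm -> seq R) (zs : W -> seq (@noise R)).
Hypothesis size_obs : forall w i, size (obs w i) = m i.
Hypothesis measurable_obs : forall i,
  measurable_fun setT (fun w => \sum_(x <- obs w i) x).
Hypothesis size_zs : forall w, size (zs w) = T.
Hypothesis measurable_zs : forall t, (t < T)%N ->
  measurable_fun setT (fun w => nth (false, false, (0, 0)) (zs w) t).

Notation h t w := (run (obs w) s (zs w) t).

Let noise_at t w := nth (false, false, (0, 0)) (zs w) t.

Let simple_draws t : (t < T)%N -> simple_rv (fun w => (noise_at t w).1).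
Proof.
move=> tT; have mz := measurable_zs tT.
rewrite (_ : (fun w => _) = (fun w => ((noise_at t w).1.1, (noise_at t w).1.2))).
  apply: simple_rv_pair; apply: simple_rv_bool.
  - apply: (measurableT_comp measurable_fst).
    exact: (measurableT_comp measurable_fst mz).
  - apply: (measurableT_comp measurable_snd).
    exact: (measurableT_comp measurable_fst mz).
by apply/funext => w; case: (noise_at t w) => -[].
Qed.

Let measurable_rewards t b : (t < T)%N ->
  measurable_fun setT (fun w => if b then (noise_at t w).2.2 else (noise_at t w).2.1).
Proof.
move=> tT; have mz := measurable_zs tT; case: b.
- apply: (measurableT_comp measurable_snd).
  exact: (measurableT_comp measurable_snd mz).
- apply: (measurableT_comp measurable_fst).
  exact: (measurableT_comp measurable_snd mz).
Qed.

Let runS_noise t w : (t < T)%N -> h t.+1 w =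
  play (obs w) s (h t w) (noise_at t w).
Proof.
move=> tT; rewrite /run (take_nth (false, false, (0, 0))) ?size_zs //.
by rewrite foldl_rcons.
Qed.

Let cands t a w :=
  candidates (obs w) (h t w) (s (principal_view (h t w)) a).

Let playedE t w : (t < T)%N -> exists r,
  h t.+1 w = rcons (h t w)
    (Round (s (principal_view (h t w)) (noise_at t w).1.1) r
      (if r then (noise_at t w).2.2 else (noise_at t w).2.1)) /\
  r = if (noise_at t w).1.2 \in cands t (noise_at t w).1.1 w
      then (noise_at t w).1.2 else ~~ (noise_at t w).1.2.
Proof.
move=> tT; rewrite runS_noise // /cands; case: (noise_at t w) => -[a c] [x0 x1] /=.
by eexists; split; first reflexivity.
Qed.

Let measurable_emp t i :
  simple_rv (fun w => principal_view (h t w)) ->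
  measurable_fun setT (fun w => \sum_(x <- observations (obs w) (h t w) i) x) ->
  measurable_fun setT (fun w => empirical_mean (obs w) (h t w) i).
Proof.
move=> sv ms.
pose G (v : @view R) w := (\sum_(x <- observations (obs w) (h t w) i) x) / (plays m v i)%:R.
rewrite (_ : (fun w => _) = (fun w => G (principal_view (h t w)) w)).
  by apply: simple_rv_measurable sv _ => v; apply: measurable_funM.
by apply/funext => w; rewrite /G (plays_view (size_obs w)).
Qed.

Let simple_cands t a :
  simple_rv (fun w => principal_view (h t w)) ->
  (forall i, measurable_fun setT (fun w => empirical_mean (obs w) (h t w) i)) ->
  simple_rv (cands t a).
Proof.
move=> sv me.
pose G i (v : @view R) w := best (empirical_mean (obs w) (h t w)) (s v a) i.
have sG i : simple_rv (fun w => G i (principal_view (h t w)) w).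
  apply: simple_rv_bool_family => // v; apply: measurable_fun_ler;
    exact: measurable_funD.
have := simple_rv_pair sv (simple_rv_pair (sG true) (sG false)).
move=> /(simple_rv_comp (fun x : @view R * (bool * bool) =>
  candidates_of (fun i => if i then x.2.1 else x.2.2) (s x.1 a))).
congr simple_rv; apply/funext => w; rewrite /cands candidates_ofE /=.
by congr candidates_of; apply/funext => -[].
Qed.

(** The two claims need a joint induction: the next arm depends on comparing the sums of rewards,
    and the next sums depend on the arm played. *)
Lemma history_measurable t : (t <= T)%N ->
  simple_rv (fun w => principal_view (h t w)) /\
  forall i, measurable_fun setT (fun w => \sum_(x <- observations (obs w) (h t w) i) x).
Proof.
elim: t => [_|t IHt tT].
  split=> [|i]; rewrite /run.
    rewrite (_ : (fun w => _) = (fun=> [::])); first exact: simple_rv_cst.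
    by apply/funext => w; rewrite take0.
  rewrite (_ : (fun w => _) = (fun w => \sum_(x <- obs w i) x)) //.
  by apply/funext => w; rewrite take0 /observations /= cats0.
have [sv ms] := IHt (ltnW tT).
have me i := measurable_emp sv (ms i).
have sC a := simple_cands a sv me.
have sn := simple_draws tT.
(* The chosen arm as a function of simple variables: the view, the pair of draw and tie-break, and
   the candidate sets for each of the two draws. *)
pose F (x : (@view R * (bool * bool)) * ({set arm} * {set arm})) : arm :=
  if x.1.2.2 \in (if x.1.2.1 then x.2.1 else x.2.2) then x.1.2.2 else ~~ x.1.2.2.
have sx := simple_rv_pair (simple_rv_pair sv sn) (simple_rv_pair (sC true) (sC false)).
set X := (fun w => _) in sx.
have hS w : h t.+1 w = rcons (h t w)
    (Round (s (principal_view (h t w)) (noise_at t w).1.1) (F (X w))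
      (if F (X w) then (noise_at t w).2.2 else (noise_at t w).2.1)).
  have [r [-> ->]] := playedE w tT; rewrite /F /X /=.
  by case: (noise_at t w).1 => -[].
split=> [|i].
  have := simple_rv_comp (fun x => rcons x.1.1 (s x.1.1 x.1.2.1, F x)) sx.
  congr simple_rv; apply/funext => w /=.
  by rewrite hS /principal_view map_rcons.
have sFX := simple_rv_comp F sx.
pose G (r : arm) w := \sum_(x <- observations (obs w) (h t w) i) x +
  (if r == i then if r then (noise_at t w).2.2 else (noise_at t w).2.1 else 0).
rewrite (_ : (fun w => _) = (fun w => G (F (X w)) w)).
  apply: simple_rv_measurable sFX _ => r; apply: measurable_funD => //.
  by case: (r == i) => //; exact: measurable_rewards.
apply/funext => w; rewrite hS observations_rcons /G /=.
by case: ifP => _; rewrite ?big_rcons /= ?addr0.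
Qed.

Lemma simple_candidates t a : (t <= T)%N -> simple_rv (cands t a).
Proof.
move=> /history_measurable[sv ms]; apply: simple_cands => // i.
exact: measurable_emp.
Qed.

Lemma simple_sel_prob t : (t <= T)%N ->
  simple_rv (fun w => sel_prob (obs w) s (h t w)).
Proof.
move=> tT.
have := simple_rv_comp (fun (x : {set arm} * {set arm}) (j : arm) =>
  \sum_(a : arm) 2^-1 * (let C := if a then x.1 else x.2 in
     if j \in C then #|C|%:R^-1 else 0) : R)
  (simple_rv_pair (simple_candidates true tT) (simple_candidates false tT)).
congr simple_rv; apply/funext => w; apply/funext => j /=.
by apply: eq_bigr => -[].
Qed.

Lemma measurable_fair (mu : arm -> R) t : (t <= T)%N ->
  measurable [set w | fair (obs w) s mu (h t w)].
Proof.
move=> tT; have [_ mf] := simple_sel_prob tT.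
exact: mf [set f | forall j j' : arm, f j' < f j -> mu j' < mu j].
Qed.

Lemma measurable_cost t : (t <= T)%N ->
  measurable_fun setT (fun w => \sum_(r <- h t w) offered r (played r)).
Proof.
move=> /history_measurable[sv _]; apply: simple_rv_fun.
have := simple_rv_comp (fun v : @view R => \sum_(x <- v) x.1 x.2) sv.
congr simple_rv; apply/funext => w /=.
by rewrite /principal_view big_map.
Qed.

Lemma measurable_sel_prob t i : (t <= T)%N ->
  measurable_fun setT (fun w => sel_prob (obs w) s (h t w) i).
Proof.
move=> tT; apply: simple_rv_fun.
exact: (simple_rv_comp (fun f : arm -> R => f i) (simple_sel_prob tT)).
Qed.

Lemma measurable_observations_sum (F : R -> nat -> R) t i : (t <= T)%N ->
  (forall n, measurable_fun setT (F ^~ n)) ->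
  measurable_fun setT (fun w =>
    F (\sum_(x <- observations (obs w) (h t w) i) x)
      (size (observations (obs w) (h t w) i))).
Proof.
move=> /history_measurable[sv ms] mF.
pose G (v : @view R) w := F (\sum_(x <- observations (obs w) (h t w) i) x) (plays m v i).
rewrite (_ : (fun w => _) = (fun w => G (principal_view (h t w)) w)).
  apply: simple_rv_measurable sv _ => v.
  exact: (measurableT_comp (mF (plays m v i)) (ms i)).
by apply/funext => w; rewrite /G (plays_view (size_obs w)).
Qed.

End HistoryMeasurability.

(** * Deviation probabilities *)

Section Law.
Context (R : realType) (F : arm -> probability R R) (m : arm -> nat) (T : nat).
Hypothesis F01 : forall i, F i `[0, 1]%classic = 1%E.

Let coin : probability bool R := bernoulli_prob 2^-1.
Let noise_law : probability (bool * bool * (R * R))%type R :=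
  ((coin \x coin) \x (F false \x F true))%E.
Let obs_law : probability ((m false).-tuple R * (m true).-tuple R)%type R :=
  (iid (F false) (m false) \x iid (F true) (m true))%E.

Let half01 : 0 <= (2^-1 : R) <= 1.
Proof. by lra. Qed.

(** Conditioning on the initial observations: the product measure is by definition the integral of
    the measures of sections. *)
Lemma law_le (B : set (@outcome R m T)) (f : _ -> \bar R) :
  (forall o, iid noise_law T (xsection B o) <= f o)%E ->
  (law F m T B <= \int[obs_law]_o f o)%E.
Proof.
move=> Bf; apply: ge0_le_integralT => o; last exact: Bf.
exact: measure_ge0.
Qed.

(** The factor that one observation contributes to the exponential supermartingale. *)
Definition reward_mgf (i : arm) (l x : R) : R :=
  expR (l * (x - mean F i) - l ^+ 2 / 8).

Lemma measurable_reward_mgf i l : measurable_fun setT (reward_mgf i l).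
Proof.
apply: measurableT_comp => //; apply: measurable_funB => //.
by apply: measurable_funM => //; exact: measurable_funB.
Qed.

(** The history, the draw and the tie-break determine the played arm before the fresh rewards are
    integrated. If it is [i], the product gains a factor of mean at most 1; otherwise it is
    unchanged. *)
Lemma reward_mgf_step (s : scheme) (obs0 : arm -> seq R) (i : arm) (l c : R)
    (h : @history R) : 0 <= c ->
  (\int[noise_law]_z (c * \prod_(x <- observations obs0 (play obs0 s h z) i)
     reward_mgf i l x)%:E <=
   (c * \prod_(x <- observations obs0 h i) reward_mgf i l x)%:E)%E.
Proof.
move=> c0; set M := c * _.
have g0 x : 0 <= reward_mgf i l x by exact: expR_ge0.
have M0 : 0 <= M by rewrite mulr_ge0 // prodr_ge0.
have mg := measurable_reward_mgf i l.
pose j (ac : bool * bool) : arm :=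
  Defs.choose obs0 h (s (principal_view h) ac.1) ac.2.
pose G (ac : bool * bool) (y : R * R) : R :=
  if j ac == i then M * reward_mgf i l (if i then y.2 else y.1) else M.
have mG ac : measurable_fun [set: R * R] (G ac).
  rewrite /G; case: (j ac == i) => //; apply: measurable_funM => //.
  apply: measurableT_comp mg _; case: (i);
    [exact: measurable_snd|exact: measurable_fst].
have playE z : c * \prod_(x <- observations obs0 (play obs0 s h z) i)
    reward_mgf i l x = G z.1 z.2.
  case: z => -[a b] [x0 x1] /=; rewrite observations_rcons /= /G -/(j (a, b)) /=.
  have [->|//] := eqVneq (j (a, b)) i.
  by rewrite big_rcons /= mulrA.
under eq_integral do rewrite playE.
have sfst : simple_rv (fst : (bool * bool) * (R * R) -> bool * bool).
  rewrite (_ : fst = (fun z => (z.1.1, z.1.2))); last by apply/funext => -[[]].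
  apply: simple_rv_pair; apply: simple_rv_bool.
  - exact: (measurableT_comp measurable_fst measurable_fst).
  - exact: (measurableT_comp measurable_snd measurable_fst).
apply: prod_integral_le => [|z|ac].
- apply/measurable_EFinP.
  apply: (simple_rv_measurable (G := fun ac z => G ac z.2) sfst) => ac.
  exact: measurableT_comp (mG ac) measurable_snd.
- by rewrite lee_fin /G; case: ifP => // _; exact: mulr_ge0.
rewrite /= /G; case: (j ac == i); last by rewrite probability_integral_cst.
have Mg (k : arm) : k = i ->
    (\int[F k]_x (M * reward_mgf i l x)%:E <= M%:E)%E.
  move=> ->; under eq_integral do rewrite EFinM.
  rewrite ge0_integralZl //; last 2 first.
  - by apply/measurable_EFinP; exact: mg.
  - by move=> x _; rewrite lee_fin.
  rewrite -[leRHS]mule1 lee_wpmul2l ?lee_fin //.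
  exact: (hoeffding_le1 (F01 i) l).
have mMg : measurable_fun setT (fun x => (M * reward_mgf i l x)%:E).
  by apply/measurable_EFinP; exact: measurable_funM.
have Mg0 x : (0 <= (M * reward_mgf i l x)%:E)%E by rewrite lee_fin mulr_ge0.
case: (i) (Mg) (mMg) (Mg0) => {}Mg {}mMg {}Mg0.
  by rewrite (prod_integral_snd (F false) (F true) mMg Mg0); exact: Mg.
by rewrite (prod_integral_fst (F false) (F true) mMg Mg0); exact: Mg.
Qed.

(** Given the initial observations, [ville] bounds the crossing probability by the starting value,
    whose mean over those observations is at most [c]. *)
Lemma reward_ville (s : scheme) (i : arm) (l c : R) : 0 <= c ->
  (law F m T [set w : @outcome R m T | exists2 t : nat, (t <= T)%N &
     (1 <= c * \prod_(x <- observations (initial_obs w)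
        (run (initial_obs w) s w.2 t) i) reward_mgf i l x)%R] <= c%:E)%E.
Proof.
move=> c0; have g0 x : 0 <= reward_mgf i l x by exact: expR_ge0.
pose obs_of (o : (m false).-tuple R * (m true).-tuple R) (j : arm) : seq R :=
  if j then o.2 : seq R else o.1 : seq R.
pose f o : \bar R := (c * \prod_(x <- obs_of o i) reward_mgf i l x)%:E.
apply: (@le_trans _ _ (\int[obs_law]_o f o)%E).
  apply: law_le => o.
  have M0 h : 0 <= c * \prod_(x <- observations (obs_of o) h i) reward_mgf i l x.
    by rewrite mulr_ge0 // prodr_ge0.
  have Mstep h := reward_mgf_step s (obs_of o) i l h c0.
  have := ville M0 Mstep T [::].
  rewrite /f [observations _ [::] _]cats0; apply: le_trans.
  rewrite le_eqVlt; apply/orP; left; apply/eqP; congr (iid _ _ _).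
  by apply/seteqP; split => zs; rewrite /xsection /= inE.
have mprod k : measurable_fun setT
    (fun xs : k.-tuple R => (\prod_(x <- xs) reward_mgf i l x)%:E).
  apply/measurable_EFinP.
  rewrite (_ : (fun _ => _) =
      (fun xs : k.-tuple R => \prod_(j < k) reward_mgf i l (tnth xs j))); last first.
    by apply/funext => xs; rewrite big_tuple.
  apply: measurable_prod => j _; apply: measurableT_comp (measurable_reward_mgf i l) _.
  exact: measurable_tnth.
have prod0 (xs : seq R) : (0 <= (\prod_(x <- xs) reward_mgf i l x)%:E)%E.
  by rewrite lee_fin prodr_ge0.
rewrite /f; under eq_integral do rewrite EFinM.
have le1 k : (\int[iid (F i) k]_xs (\prod_(x <- xs) reward_mgf i l x)%:E <= 1)%E.
  apply: iid_integral_prod_le1 => //; first exact: measurable_reward_mgf.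
  exact: (hoeffding_le1 (F01 i) l).
have mobs : measurable_fun setT (fun o => (\prod_(x <- obs_of o i) reward_mgf i l x)%:E).
  rewrite /obs_of; case: (i) (mprod) => mprod'.
    exact: (measurableT_comp (mprod' (m true)) measurable_snd).
  exact: (measurableT_comp (mprod' (m false)) measurable_fst).
rewrite ge0_integralZl //.
rewrite -[leRHS]mule1 lee_wpmul2l ?lee_fin // /obs_of.
case: (i) (mprod) (prod0) (le1) => {}mprod {}prod0 {}le1.
  rewrite (prod_integral_snd (iid (F false) (m false)) (iid (F true) (m true))
    (mprod _) (fun xs => prod0 xs)); exact: le1.
rewrite (prod_integral_fst (iid (F false) (m false)) (iid (F true) (m true))
  (mprod _) (fun xs => prod0 xs)); exact: le1.
Qed.

(** The process involves the coin tosses alone, so the state fed to [ville] is the list of noises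
    itself, extended by [rcons]. *)
Lemma draws_ville (j : arm) (c : R) : 0 <= c ->
  (law F m T [set w : @outcome R m T | exists2 t : nat, (t <= T)%N &
     (1 <= c * (4 / 3) ^+ t *
       2^-1 ^+ count (fun z : @noise R => z.1.1 == j) (take t w.2))%R] <= c%:E)%E.
Proof.
move=> c0; rewrite -[leRHS](probability_integral_cst obs_law); apply: law_le => o.
pose M (zs : seq (@noise R)) : R :=
  c * (4 / 3) ^+ size zs * 2^-1 ^+ count (fun z => z.1.1 == j) zs.
have M0 zs : 0 <= M zs by rewrite !mulr_ge0 // exprn_ge0.
have Mstep zs : (\int[noise_law]_z (M (rcons zs z))%:E <= (M zs)%:E)%E.
  pose g (a : bool) : \bar R := (M zs * (4 / 3 * (if a == j then 2^-1 else 1)))%:E.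
  have g0 a : (0 <= g a)%E by rewrite lee_fin !mulr_ge0 //; case: ifP.
  have mg : measurable_fun setT g by [].
  have ME z : (M (rcons zs z))%:E = g z.1.1.
    rewrite /g /M size_rcons -cats1 count_cat /= addn0 exprS exprD; congr EFin.
    move: (_ ^+ size zs) (_ ^+ count _ zs) => u v.
    by case: (z.1.1 == j) => /=; rewrite ?expr0 ?expr1; ring.
  under eq_integral do rewrite ME.
  have mg1 : measurable_fun [set: bool * bool] (g \o fst).
    exact: measurableT_comp mg measurable_fst.
  rewrite (prod_integral_fst (coin \x coin)%E (F false \x F true)%E mg1
    (fun ab => g0 ab.1)).
  rewrite (prod_integral_fst coin coin mg g0).
  rewrite integral_bernoulli_prob // /g -!EFinM -EFinD lee_fin.
  rewrite le_eqVlt; apply/orP; left; apply/eqP.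
  by rewrite /unstable.onem; case: (j) => /=; field.
have := ville M0 Mstep T [::].
rewrite [M [::]]/M /= expr0 !mulr1; apply: le_trans.
rewrite le_eqVlt; apply/orP; left; apply/eqP; congr (iid _ _ _).
have foldl_rcons_nil (zs : seq (@noise R)) : foldl rcons [::] zs = zs.
  by elim/last_ind: zs => // zs z IH; rewrite foldl_rcons IH.
have ME (zs : T.-tuple (@noise R)) t : (t <= T)%N -> M (foldl rcons [::] (take t zs)) =
    c * (4 / 3) ^+ t * 2^-1 ^+ count (fun z : @noise R => z.1.1 == j) (take t zs).
  by move=> tT; rewrite foldl_rcons_nil /M size_takel // size_tuple.
apply/seteqP; split => zs; rewrite /xsection /= inE /= => -[t tT Mt]; exists t => //.
  by rewrite ME.
by rewrite -ME.
Qed.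

End Law.

(** * Numerical bounds on the logarithms and the series *)

Section Numeric.
Context (R : realType) (delta : R).
Hypothesis delta01 : 0 < delta < 1.

(** The factor 4 counts two arms and two signs. With [pi >= 2] and [b = k + 2], a term is at most
    [9/4 delta^2 / b^4], hence at most [9/16 delta / ((b - 1) b)], which telescopes. The constant
    below 1 leaves room for the event on draws. *)
Lemma sum_expR_logw (n : nat) :
  \sum_(k < n) 4 * expR (- (2 * logw delta k)) <= 9 / 16 * delta.
Proof.
have /andP[d0 d1] := delta01.
have term k : 4 * expR (- (2 * logw delta k)) <=
    9 / 16 * delta * (k.+1%:R^-1 - k.+2%:R^-1).
  set q := (pi * k.+2%:R) ^+ 2 / (3 * delta).
  have q0 : 0 < q by rewrite (lt_trans ltr01) // logw_arg_gt1.
  have -> : expR (- (2 * logw delta k)) = q ^- 2.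
    by rewrite expRN mulrC expRM_natr /logw lnK.
  have k1 : 1 <= k.+1%:R :> R by rewrite ler1n.
  have k2E : k.+2%:R = k.+1%:R + 1 :> R by rewrite natr1.
  have pi2 := @pi_ge2 R.
  move: k1 k2E; rewrite /q; move: k.+1%:R => a a1 ->.
  set b := a + 1; have b2 : 2 <= b by rewrite /b; lra.
  have pb : 4 * b ^+ 2 <= (pi * b) ^+ 2.
    rewrite exprMn ler_wpM2r ?sqr_ge0 //; nra.
  have b0 : 0 < b by lra.
  have bb : 0 < b ^+ 2 by rewrite exprn_gt0.
  have qb : 4 * b ^+ 2 / (3 * delta) <= (pi * b) ^+ 2 / (3 * delta).
    by rewrite ler_wpM2r // invr_ge0; lra.
  have qb0 : 0 < 4 * b ^+ 2 / (3 * delta) by rewrite divr_gt0 ?mulr_gt0.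
  apply: (@le_trans _ _ (4 * (4 * b ^+ 2 / (3 * delta)) ^- 2)).
    rewrite ler_pM2l // lef_pV2 ?posrE ?exprn_gt0 ?(lt_le_trans qb0) //.
    by rewrite ler_sqr ?nnegrE ?(ltW qb0) ?(ltW (lt_le_trans qb0 qb)).
  have -> : 4 * (4 * b ^+ 2 / (3 * delta)) ^- 2 = (9 / 4 * delta) * (delta * b ^- 4).
    by field; rewrite !gt_eqF.
  have -> : a^-1 - b^-1 = (a * b)^-1.
    by rewrite /b; field; rewrite !gt_eqF //; lra.
  have -> : 9 / 16 * delta * (a * b)^-1 = (9 / 4 * delta) * (4 * (a * b))^-1.
    by field; rewrite !gt_eqF //; lra.
  rewrite ler_wpM2l ?mulr_ge0 ?(ltW d0) //.
  apply: (@le_trans _ _ (b ^- 4)).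
    by rewrite ler_piMl ?(ltW d1) // invr_ge0 exprn_ge0 // ltW.
  rewrite lef_pV2 ?posrE ?exprn_gt0 ?mulr_gt0 //; last lra.
  have -> : b ^+ 4 = (b ^+ 2) * (b ^+ 2) by ring.
  apply: ler_pM; rewrite ?mulr_ge0 //; [lra|lra| |]; rewrite /b; nra.
apply: (le_trans (ler_sum _ (fun (k : 'I_n) _ => term k))).
rewrite -mulr_sumr ler_piMr ?mulr_ge0 ?(ltW d0) //.
rewrite -(big_mkord xpredT (fun k => k.+1%:R^-1 - k.+2%:R^-1 : R)).
have -> : \sum_(0 <= k < n) (k.+1%:R^-1 - k.+2%:R^-1 : R) = 1 - n.+1%:R^-1.
  elim: n => [|n IHn]; first by rewrite big_geq // invr1 subrr.
  by rewrite big_nat_recr //= IHn addrA subrK.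
by rewrite lerBlDr lerDl invr_ge0.
Qed.

Lemma ln_nat_le (n k : nat) : (0 < n)%N -> (n <= 2 ^ k)%N -> ln n%:R <= k%:R :> R.
Proof.
move=> n0 nk; apply: (@le_trans _ _ (ln ((2 : R) ^+ k))).
  by rewrite ler_ln ?posrE ?ltr0n ?exprn_gt0 // -natrX ler_nat.
rewrite lnXn // -[ln 2 *+ k]mulr_natr ler_piMl //.
have ltN11 : -1 < 1 :> R by lra.
exact: le_ln1Dx ltN11.
Qed.

Variable T : nat.
Hypothesis T0 : (0 < T)%N.

Let xy : R := (1 + ln T%:R) * (1 + ln delta^-1).
(** The logarithm of the inverse of [delta / (8 * T)], the failure probability allotted to the draws
    of one arm. *)
Let l : R := ln (8 * T%:R / delta).

Let T1 : 1 <= T%:R :> R. Proof. by rewrite ler1n. Qed.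
Let lnT0 : 0 <= ln (T%:R : R). Proof. exact: ln_ge0. Qed.
Let lnd0 : 0 <= ln delta^-1.
Proof. by have /andP[d0 d1] := delta01; rewrite ln_ge0 // invf_ge1 // ltW. Qed.

Let xy1 : 1 <= xy.
Proof. by have := lnT0; have := lnd0; rewrite /xy; nra. Qed.

Lemma draw_level_ge0 : 0 <= l.
Proof.
have /andP[d0 d1] := delta01.
by rewrite ln_ge0 // ler_pdivlMr // mul1r; have := T1; lra.
Qed.

Let draw_level_le : 1 + l <= 4 * xy.
Proof.
have /andP[d0 d1] := delta01.
rewrite /l !lnM ?posrE ?mulr_gt0 ?invr_gt0 ?ltr0n //.
have := @ln_nat_le 8 3 isT isT; have := mulr_ge0 lnT0 lnd0.
by have := lnT0; have := lnd0; rewrite /xy; nra.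
Qed.

Lemma logw_T_le : logw delta T <= 6 * xy.
Proof.
have /andP[d0 d1] := delta01.
have pi4 : pi <= 4 :> R by have := @pihalf_lt2 R; lra.
have pi0 := @pi_gt0 R.
(* From [pi <= 4] and [T + 2 <= 3 T] the squared factor is at most [(12 T)^2], and
   [144 / 3 = 48]. *)
apply: (@le_trans _ _ (ln (48 * T%:R ^+ 2 / delta))).
  rewrite ler_ln ?posrE ?(lt_trans ltr01 (logw_arg_gt1 _ _)) //; last first.
    by rewrite divr_gt0 // mulr_gt0 // exprn_gt0 // ltr0n.
  have -> : 48 * T%:R ^+ 2 / delta = (12 * T%:R) ^+ 2 / (3 * delta).
    by field; rewrite gt_eqF.
  rewrite ler_pM2r ?invr_gt0 ?mulr_gt0 // ler_sqr ?nnegrE ?mulr_ge0 ?(ltW pi0) //.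
  have -> : T.+2%:R = T%:R + 2 :> R by rewrite -addn2 natrD.
  have := T1; nra.
have T_gt0 : 0 < T%:R :> R by rewrite ltr0n.
rewrite !lnM ?posrE ?mulr_gt0 ?exprn_gt0 ?invr_gt0 //.
have := @ln_nat_le 48 6 isT isT; have := mulr_ge0 lnT0 lnd0.
by have := lnT0; have := lnd0; rewrite /xy; nra.
Qed.

Let sqrt_le (a b : R) : 0 <= b -> a <= b ^+ 2 -> Num.sqrt a <= b.
Proof. by move=> b0 ab; rewrite -(ger0_norm b0) -sqrtr_sqr ler_wsqrtr. Qed.

(** Here [83 = 16 * 5 + 3]: as [xy >= 1], the roots of [24 * xy ^+ 2] and of [6 * xy] are at most
    [5 * xy] and [3 * xy]. The second summand on the left makes room for the expected cost on the
    event of bad draws. *)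
Lemma bound_le :
  16 * Num.sqrt T%:R * Num.sqrt (logw delta T * (1 + l)) +
    Num.sqrt (logw delta T) <= sqrt_polylog 83 1 1 T delta.
Proof.
have L0 := logw_gt0 delta01 T; have l0 := draw_level_ge0; have xy_1 := xy1.
have sT1 : 1 <= Num.sqrt T%:R :> R by rewrite -[leLHS]sqrtr1 ler_wsqrtr.
have s1 : Num.sqrt (logw delta T * (1 + l)) <= 5 * xy.
  apply: sqrt_le; first lra.
  apply: (@le_trans _ _ ((6 * xy) * (4 * xy))).
    apply: ler_pM; [lra|lra|exact: logw_T_le|exact: draw_level_le].
  nra.
have s2 : Num.sqrt (logw delta T) <= 3 * xy.
  apply: sqrt_le; first lra.
  by apply: (le_trans logw_T_le); nra.
rewrite /sqrt_polylog !expr1 -mulrA -[leRHS]mulrA -/xy.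
move: (Num.sqrt T%:R) sT1 => c c1.
have cs1 : c * Num.sqrt (logw delta T * (1 + l)) <= c * (5 * xy).
  by rewrite ler_pM2l //; lra.
have cxy : xy <= c * xy by rewrite ler_peMl //; lra.
by rewrite -[leRHS]mulrA; lra.
Qed.

End Numeric.

(** * Finite unions of events, and expectations split along an event *)

Section FiniteUnions.
Context (d : measure_display) (W : measurableType d) (R : realType).
Variable P : probability W R.

Lemma measurable_ex2 (D : set nat) (A : nat -> set W) :
  (forall t, D t -> measurable (A t)) ->
  measurable [set w | exists2 t, D t & A t w].
Proof. by move=> mA; apply: bigcup_measurable. Qed.

Lemma measurable_all (A : nat -> set W) (n : nat) :
  (forall t, (t < n)%N -> measurable (A t)) ->
  measurable [set w | forall t, (t < n)%N -> A t w].
Proof.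
move=> mA; rewrite (_ : [set w | _] = \bigcap_(t in [set t | (t < n)%N]) A t) //.
exact: bigcap_measurableType.
Qed.

Lemma measure_ex2_le (A : nat -> set W) (b : nat -> R) (n : nat) :
  (forall k, (k < n)%N -> measurable (A k)) ->
  (forall k, (k < n)%N -> (P (A k) <= (b k)%:E)%E) ->
  (P [set w | exists2 k : nat, (k < n)%N & A k w] <= (\sum_(k < n) b k)%:E)%E.
Proof.
move=> mA Ab; rewrite (_ : [set w | _] = \big[setU/set0]_(k < n) A k); last first.
  by rewrite -bigcup_mkord.
apply: le_trans (Boole_inequality P mA) _.
by rewrite -sumEFin; apply: lee_sum => k _; exact: Ab.
Qed.

Lemma measureU_le (A B : set W) (a b : R) : measurable A -> measurable B ->
  (P A <= a%:E)%E -> (P B <= b%:E)%E -> (P (A `|` B) <= (a + b)%:E)%E.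
Proof.
move=> mA mB Aa Bb; apply: (@le_trans _ _ (P A + P B)%E); first exact: measureU2.
by rewrite EFinD; exact: leeD.
Qed.

Lemma probability_setC_ge (A B : set W) (p : R) : measurable A -> measurable B ->
  ~` B `<=` A -> (P B <= p%:E)%E -> ((1 - p)%:E <= P A)%E.
Proof.
move=> mA mB BA Bp; apply: (@le_trans _ _ (P (~` B))).
  by rewrite probability_setC // EFinB leeB.
by apply: le_measure; rewrite ?inE //; exact: measurableC.
Qed.

Lemma expectation_le_indic (X : W -> R) (A : set W) (a c p : R) :
  measurable A -> 0 <= a -> 0 <= c -> (forall w, 0 <= X w) ->
  (forall w, ~ A w -> X w <= a) -> (forall w, X w <= a + c) ->
  (P A <= p%:E)%E -> ('E_P[X] <= (a + c * p)%:E)%E.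
Proof.
move=> mA a0 c0 X0 Xa Xc Ap; rewrite unlock.
apply: (@le_trans _ _ (\int[P]_w (a%:E + c%:E * (\1_A w)%:E))%E).
  apply: ge0_le_integralT => w; first by rewrite lee_fin.
  rewrite /= -EFinM -EFinD lee_fin indicE.
  case: (boolP (w \in A)) => [_|/negP Aw]; first by rewrite mulr1.
  by rewrite mulr0 addr0 Xa // => Aw'; apply: Aw; rewrite inE.
have m1 : measurable_fun setT (fun w => (\1_A w)%:E : \bar R).
  by apply/measurable_EFinP; exact: measurable_indic.
rewrite ge0_integralD //; last 2 first.
- by move=> w _; rewrite mule_ge0 // lee_fin.
- exact: measurable_funeM.
rewrite ge0_integralZl // integral_indic // setIT probability_integral_cst.
by rewrite EFinD EFinM leeD2l // lee_wpmul2l.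
Qed.

End FiniteUnions.

(** * The exceptional event and its complement *)

Section BadEvents.
Context (R : realType) (F : arm -> probability R R) (m : arm -> nat) (delta : R).
Variable T : nat.
Hypothesis F01 : forall i, F i `[0, 1]%classic = 1%E.
Hypothesis m_gt0 : forall i, (0 < m i)%N.
Hypothesis delta01 : 0 < delta < 1.
Hypothesis T_gt0 : (0 < T)%N.

Notation W := (@outcome R m T).
Notation s := (CW_scheme delta m).
Notation P := (law F m T).
Notation mu := (mean F).
Notation obs w i t := (observations (initial_obs w) (hist delta w t) i).

Let d0 : 0 < delta. Proof. by case/andP: delta01. Qed.

Lemma size_initial_obs (w : W) i : size (initial_obs w i) = m i.
Proof. by case: i; rewrite size_tuple. Qed.

Lemma measurable_initial_obs i :
  measurable_fun setT (fun w : W => \sum_(x <- initial_obs w i) x).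
Proof.
have msum k : measurable_fun setT (fun xs : k.-tuple R => \sum_(x <- xs) x).
  rewrite (_ : (fun _ => _) = (fun xs : k.-tuple R => \sum_(j < k) tnth xs j)).
    by apply: measurable_sum => j; exact: measurable_tnth.
  by apply/funext => xs; rewrite big_tuple.
case: i.
  exact: (measurableT_comp (msum (m true)) (measurableT_comp measurable_snd measurable_fst)).
exact: (measurableT_comp (msum (m false)) (measurableT_comp measurable_fst measurable_fst)).
Qed.

Lemma measurable_noise t : (t < T)%N ->
  measurable_fun setT (fun w : W => nth (false, false, (0, 0)) w.2 t).
Proof.
move=> tT; rewrite (_ : (fun w => _) = (fun w : W => tnth w.2 (Ordinal tT))).
  exact: (measurableT_comp (measurable_tnth _) measurable_snd).
by apply/funext => w; rewrite (tnth_nth (false, false, (0, 0))).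
Qed.

Let size_noise (w : W) : size (w.2 : seq (@noise R)) = T.
Proof. exact: size_tuple. Qed.

Definition rate (i : arm) (k : nat) : R := Num.sqrt (logw delta k / (m i + k)%:R).

(* The line of [good] has slope [rate / 2]; the Hoeffding supermartingale whose
   crossing level is a line of slope [b] is the one with exponent [8 * b]. *)
Definition tilt (i : arm) (up : bool) (k : nat) : R :=
  (if up then 4 else - 4) * rate i k.

(** The weight is the one-sided Hoeffding tail for exactly [m i + k] observations and deviation
    [rate i k], so the whole line costs no more than the bound at that single sample size. *)
Definition reward_bad (i : arm) (up : bool) (k : nat) : set W :=
  [set w : W | exists2 t : nat, (t <= T)%N &
    1 <= expR (- (2 * logw delta k)) *
      \prod_(x <- obs w i t) reward_mgf F i (tilt i up k) x].

(* [4 / 3] is the inverse of the mean of [2^-1 ^+ (a == j)] for a uniform [a]. *)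
Definition draw_bad (j : arm) : set W :=
  [set w : W | exists2 t : nat, (t <= T)%N &
    1 <= delta / (8 * T%:R) * (4 / 3) ^+ t *
       2^-1 ^+ count (fun z : @noise R => z.1.1 == j) (take t w.2)].

Definition rewards_bad : set W := [set w | exists2 k : nat, (k < T)%N &
  ((reward_bad true true k `|` reward_bad true false k) `|`
   (reward_bad false true k `|` reward_bad false false k)) w].

Definition draws_bad : set W := draw_bad true `|` draw_bad false.

(** Only the sum and the number of the observations matter, which makes the crossing events
    measurable and the crossing level linear in that number. *)
Lemma prod_reward_mgf (i : arm) (l : R) (xs : seq R) :
  \prod_(x <- xs) reward_mgf F i l x =
  expR (l * (\sum_(x <- xs) x - mu i * (size xs)%:R) - l ^+ 2 / 8 * (size xs)%:R).
Proof.
elim: xs => [|x xs IHxs]; first by rewrite !big_nil !mulr0 subrr mulr0 subrr expR0.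
rewrite !big_cons IHxs /reward_mgf -expRD; congr expR.
by rewrite /= -[(size xs).+1]addn1 natrD; ring.
Qed.

Lemma measurable_reward_bad i up k : measurable (reward_bad i up k).
Proof.
apply: measurable_ex2 => t /= tT.
pose G (S : R) (n : nat) : R := expR (- (2 * logw delta k)) *
  expR (tilt i up k * (S - mu i * n%:R) - tilt i up k ^+ 2 / 8 * n%:R).
have mG : measurable_fun setT (fun w : W => G (\sum_(x <- obs w i t) x) (size (obs w i t))).
  apply: (measurable_observations_sum (T := T) s size_initial_obs
    measurable_initial_obs size_noise measurable_noise i tT) => n.
  apply: measurable_funM => //; apply: measurableT_comp => //.
  by apply: measurable_funB => //; apply: measurable_funM => //; exact: measurable_funB.
rewrite [X in measurable X](_ : _ = [set w : W |
    1 <= G (\sum_(x <- obs w i t) x) (size (obs w i t))]).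
  by rewrite -[X in measurable X]setTI; exact: measurable_fun_le.
by apply/funext => w /=; rewrite prod_reward_mgf.
Qed.

Lemma measurable_draw_bad j : measurable (draw_bad j).
Proof.
apply: measurable_ex2 => t /= tT.
have : simple_rv (fun w : W => count (fun z : @noise R => z.1.1 == j) (take t w.2)).
  elim: t tT => [_|t IHt tT].
    rewrite (_ : (fun w => _) = (fun=> 0%N)); first exact: simple_rv_cst.
    by apply/funext => w; rewrite take0.
  have mb : measurable_fun setT (fun w : W => (nth (false, false, (0, 0)) w.2 t).1.1).
    apply: (measurableT_comp measurable_fst).
    exact: (measurableT_comp measurable_fst (measurable_noise tT)).
  have := simple_rv_pair (IHt (ltnW tT)) (simple_rv_bool mb).
  move=> /(simple_rv_comp (fun x : nat * bool => x.1 + (x.2 == j))%N).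
  congr simple_rv; apply/funext => w /=.
  by rewrite (take_nth (false, false, (0, 0))) ?size_tuple // -cats1 count_cat /= addn0.
move=> [_ mc].
exact: mc [set n | 1 <= delta / (8 * T%:R) * (4 / 3) ^+ t * 2^-1 ^+ n].
Qed.

Lemma measurable_rewards_bad : measurable rewards_bad.
Proof.
apply: measurable_ex2 => k _.
by do 2 apply: measurableU; exact: measurable_reward_bad.
Qed.

Lemma measurable_draws_bad : measurable draws_bad.
Proof. by apply: measurableU; exact: measurable_draw_bad. Qed.

Lemma rewards_bad_le : (P rewards_bad <= (9 / 16 * delta)%:E)%E.
Proof.
have le1 i up k : (P (reward_bad i up k) <= (expR (- (2 * logw delta k)))%:E)%E.
  by apply: reward_ville => //; exact: expR_ge0.
have mb := measurable_reward_bad.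
apply: (@le_trans _ _ (\sum_(k < T) 4 * expR (- (2 * logw delta k)))%:E); last first.
  by rewrite lee_fin; exact: sum_expR_logw.
apply: (@measure_ex2_le _ _ _ P (fun k =>
    (reward_bad true true k `|` reward_bad true false k) `|`
    (reward_bad false true k `|` reward_bad false false k))
  (fun k => 4 * expR (- (2 * logw delta k)))) => k _.
  by do 2 apply: measurableU.
set e := expR _.
have -> : 4 * e = (e + e) + (e + e) by ring.
by apply: measureU_le; try exact: measurableU; apply: measureU_le => //; exact: le1.
Qed.

Lemma draws_bad_le : (P draws_bad <= (delta / (4 * T%:R))%:E)%E.
Proof.
have c0 : 0 <= delta / (8 * T%:R) by rewrite divr_ge0 ?mulr_ge0 ?(ltW d0).
have -> : delta / (4 * T%:R) = delta / (8 * T%:R) + delta / (8 * T%:R).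
  by field; rewrite pnatr_eq0 -lt0n.
by apply: measureU_le; (exact: measurable_draw_bad || exact: draws_ville).
Qed.

Definition bad : set W := rewards_bad `|` draws_bad.

Lemma measurable_bad : measurable bad.
Proof. by apply: measurableU; [exact: measurable_rewards_bad|exact: measurable_draws_bad]. Qed.

Lemma bad_le : (P bad <= delta%:E)%E.
Proof.
apply: (@le_trans _ _ (9 / 16 * delta + delta / (4 * T%:R))%:E).
  apply: measureU_le; [exact: measurable_rewards_bad|exact: measurable_draws_bad
    |exact: rewards_bad_le|exact: draws_bad_le].
rewrite lee_fin.
have : delta / (4 * T%:R) <= delta / 4.
  rewrite ler_wpM2l ?(ltW d0) // lef_pV2 ?posrE ?mulr_gt0 ?ltr0n //.
  by rewrite ler_peMr // ler1n.
by have := d0; lra.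
Qed.

(** Write [r] for the rate, [Z] for the centered sum, [n] for the number of observations. Since
    [r^2 (m i + k)] is the logarithm, not crossing means that both [4 r Z] and [- 4 r Z] are below
    [2 r^2 (m i + k + n)]; dividing by [4 r] gives the line of [good]. *)
Lemma good_of_rewards (w : W) : ~ rewards_bad w ->
  good (initial_obs w) m delta w.2 mu.
Proof.
move=> nbad i k t; rewrite size_noise => kT tT.
have n_gt0 : 0 < (m i + k)%:R :> R by rewrite ltr0n addn_gt0 m_gt0.
have L0 := logw_gt0 delta01 k.
have r_gt0 : 0 < rate i k by rewrite sqrtr_gt0 divr_gt0.
have r2 : rate i k ^+ 2 * (m i + k)%:R = logw delta k.
  by rewrite sqr_sqrtr ?divr_ge0 ?ltW // divfK ?gt_eqF.
have nbad_up j up : ~ reward_bad j up k w.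
  move=> bad_up; apply: nbad; exists k => //.
  by case: j up bad_up => -[] bad_up;
    [left; left|left; right|right; left|right; right].
have lt_up up : tilt i up k * (\sum_(x <- obs w i t) (x - mu i)) <
    2 * rate i k ^+ 2 * ((m i + k)%:R + (size (obs w i t))%:R).
  have : ~~ (1 <= expR (- (2 * logw delta k)) *
      \prod_(x <- obs w i t) reward_mgf F i (tilt i up k) x).
    by apply/negP => le1; apply: (nbad_up i up); exists t.
  rewrite -ltNge prod_reward_mgf -expRD expR_lt1.
  rewrite sumrB big_const_seq count_predT iter_addr addr0 -mulr_natr.
  have -> : tilt i up k ^+ 2 / 8 = 2 * rate i k ^+ 2.
    by rewrite /tilt; case: up; field.
  rewrite -r2; lra.
have := lt_up true; have := lt_up false; rewrite /tilt -/(rate i k).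
move: (\sum_(x <- _) _) => Z lt_f lt_t.
by rewrite ltr_norml; apply/andP; split; rewrite -(ltr_pM2l r_gt0); nra.
Qed.

Let l : R := ln (8 * T%:R / delta).

(** Replacing [4 / 3] by the smaller [expR (1/4)] and [1 / 2] by the smaller [expR (- 1)] turns the
    absence of a crossing into [- l + t / 4 - N < 0]. *)
Lemma count_of_draws (w : W) (j : arm) (t : nat) : ~ draws_bad w -> (t <= T)%N ->
  t%:R / 4 - l <= (count (fun z : @noise R => z.1.1 == j) (take t w.2))%:R.
Proof.
move=> nbad tT; set N := count _ _.
have T8 : 0 < 8 * T%:R / delta by rewrite divr_gt0 // mulr_gt0 // ltr0n.
have cE : delta / (8 * T%:R) = expR (- l).
  by rewrite expRN /l lnK ?posrE // invf_div.
have : ~~ (1 <= delta / (8 * T%:R) * (4 / 3) ^+ t * 2^-1 ^+ N).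
  apply/negP => le1; apply: nbad.
  by case: j @N le1 => N le1; [left|right]; exists t.
rewrite -ltNge cE => lt1.
have e4 : expR (4^-1) <= 4 / 3 :> R.
  have := @expR_ge1Dx R (- 4^-1); rewrite expRN => H.
  have -> : (4 / 3 : R) = (3 / 4)^-1 by field.
  rewrite -[leLHS]invrK lef_pV2 ?posrE ?invr_gt0 ?expR_gt0 //; lra.
have e2 : expR (- 1) <= 2^-1 :> R.
  rewrite expRN lef_pV2 ?posrE ?expR_gt0 //.
  by have := @expR_ge1Dx R 1.
have : expR (- l + t%:R * 4^-1 + N%:R * - 1) < 1.
  apply: le_lt_trans lt1; rewrite !expRD !expRM_natl.
  apply: ler_pM.
  - by rewrite mulr_ge0 ?exprn_ge0 ?expR_ge0.
  - by rewrite exprn_ge0 ?expR_ge0.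
  - by rewrite ler_wpM2l ?expR_ge0 // lerXn2r ?nnegrE ?expR_ge0.
  - by rewrite lerXn2r ?nnegrE ?expR_ge0.
rewrite expR_lt1; lra.
Qed.

Lemma good_fair (w : W) : ~ rewards_bad w -> fair_in_every_round F m delta T w.
Proof.
move=> /good_of_rewards gw t tT.
by apply: (fair_good (size_initial_obs w) m_gt0 delta01 gw); rewrite size_noise.
Qed.

Let potential (w : W) : R :=
  \sum_(t < T) upay (initial_obs w) delta (hist delta w t).

Lemma potential_le (w : W) : ~ draws_bad w ->
  potential w <= 16 * Num.sqrt T%:R * Num.sqrt (logw delta T * (1 + l)).
Proof.
move=> nbad.
apply: (@le_trans _ _ (\sum_(t < T) 8 * Num.sqrt (logw delta T * (1 + l)) *
    Num.sqrt (t.+1%:R^-1))).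
  apply: ler_sum => t _.
  have tT : (t < size (w.2 : seq (@noise R)))%N by rewrite size_noise.
  have := upay_le_draws (size_initial_obs w) m_gt0 delta01
    (draw_level_ge0 delta01 T_gt0) tT; rewrite size_noise; apply => i.
  by apply: count_of_draws => //; exact: ltnW.
rewrite -mulr_sumr.
have -> : 16 * Num.sqrt T%:R * Num.sqrt (logw delta T * (1 + l)) =
  8 * Num.sqrt (logw delta T * (1 + l)) * (2 * Num.sqrt T%:R) by ring.
by rewrite ler_wpM2l ?mulr_ge0 // sum_invsqrt_le.
Qed.

Lemma potential_le_all (w : W) :
  potential w <= T%:R * (4 * Num.sqrt (logw delta T)).
Proof.
apply: (@le_trans _ _ (\sum_(t < T) 4 * Num.sqrt (logw delta T))).
  apply: ler_sum => t _.
  have tT : (t < size (w.2 : seq (@noise R)))%N by rewrite size_noise.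
  by have := upay_le (size_initial_obs w) m_gt0 delta01 tT; rewrite size_noise.
by rewrite sumr_const card_ord [T%:R * _]mulr_natl.
Qed.

Lemma total_cost_le (w : W) : total_cost m delta T w <= potential w.
Proof.
by apply: (cost_le_upay (size_initial_obs w) m_gt0 delta01); rewrite size_noise.
Qed.

Lemma total_cost_ge0 (w : W) : 0 <= total_cost m delta T w.
Proof.
by apply: (cost_ge0 (size_initial_obs w) m_gt0 delta01); rewrite size_noise.
Qed.

Lemma regret_le (w : W) : ~ rewards_bad w -> regret F m delta T w <= potential w.
Proof.
move=> /good_of_rewards gw; apply: ler_sum => t _.
apply: (regret_round_good (size_initial_obs w) m_gt0 delta01 gw).
by rewrite size_noise.
Qed.

Let mu01 i : 0 <= mu i <= 1. Proof. exact: mean_01. Qed.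

Lemma regret_bounds (w : W) : 0 <= regret F m delta T w <= T%:R.
Proof.
have round t : 0 <= best_mean F - \sum_(i : arm)
    sel_prob (initial_obs w) s (hist delta w t) i * mu i <= 1.
  have := sum_sel_prob (initial_obs w) s (hist delta w t).
  rewrite !big_bool /=.
  have := sel_prob_ge0 (initial_obs w) s (hist delta w t) true.
  have := sel_prob_ge0 (initial_obs w) s (hist delta w t) false.
  move: (sel_prob _ _ _ true) (sel_prob _ _ _ false) => p q q0 p0 pq.
  have /andP[? ?] := mu01 true; have /andP[? ?] := mu01 false.
  by rewrite /best_mean; case: (leP (mu false) (mu true)) => ?; apply/andP; split; nra.
rewrite sumr_ge0 => [|t _]; last by case/andP: (round t).
rewrite -[leRHS]mulr1 mulr_natl -[X in _ *+ X](card_ord T) -sumr_const.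
by apply: ler_sum => t _; case/andP: (round t).
Qed.

Lemma measurable_fair_in_every_round :
  measurable [set w : W | fair_in_every_round F m delta T w].
Proof.
apply: measurable_all => t tT.
exact: (measurable_fair (T := T) s size_initial_obs measurable_initial_obs
  size_noise measurable_noise mu (ltnW tT)).
Qed.

Lemma measurable_total_cost : measurable_fun setT (total_cost m delta T : W -> R).
Proof.
exact: (measurable_cost (T := T) s size_initial_obs measurable_initial_obs
  size_noise measurable_noise (leqnn T)).
Qed.

Lemma measurable_regret : measurable_fun setT (regret F m delta T : W -> R).
Proof.
apply: measurable_sum => t; apply: measurable_funB => //.
apply: measurable_sum => i; apply: measurable_funM => //.
exact: (measurable_sel_prob (T := T) s size_initial_obs measurable_initial_obs
  size_noise measurable_noise i (ltnW (ltn_ord t))).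
Qed.

End BadEvents.

(** On the event of bad rewards, of probability of order [delta], the regret is bounded only by [T];
    this is the term [delta * T] in its expectation. The second clause gives the regret bound
    without that term, with probability at least [1 - delta] and jointly with fairness and cost. *)
Theorem theorem3p5 (R : realType) :
  exists (C : R) (a b : nat),
  forall (F : arm -> probability R R) (m : arm -> nat) (delta : R) (T : nat),
    (forall i, F i `[0, 1]%classic = 1%E) ->
    (forall i, (0 < m i)%N) ->
    0 < delta < 1 ->
    (0 < T)%N ->
    let P := law F m T in
    let bound := sqrt_polylog C a b T delta in
    [/\ ((1 - delta)%:E <= P [set w | fair_in_every_round F m delta T w])%E,
        ((1 - delta)%:E <=
           P [set w | [/\ fair_in_every_round F m delta T w,
                          (total_cost m delta T w <= bound)%R &
                          (regret F m delta T w <= bound)%R]])%E,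
        ('E_P[total_cost m delta T] <= bound%:E)%E &
        ('E_P[regret F m delta T] <= (bound + delta * T%:R)%:E)%E].

Proof.
exists 83, 1%N, 1%N => F m delta T F01 m_gt0 delta01 T_gt0 P bound.
have /andP[d0 d1] := delta01.
have T0 : 0 < T%:R :> R by rewrite ltr0n.
pose l : R := ln (8 * T%:R / delta).
pose B : R := 16 * Num.sqrt T%:R * Num.sqrt (logw delta T * (1 + l)).
have B0 : 0 <= B by rewrite !mulr_ge0.
have Bbound : B + Num.sqrt (logw delta T) <= bound by exact: bound_le.
have B_bound : B <= bound by apply: le_trans Bbound; rewrite lerDl.
have mbad : measurable (@bad R F m delta T) by exact: measurable_bad.
have badP : (P (@bad R F m delta T) <= delta%:E)%E by exact: bad_le.
have costB (w : @outcome R m T) : ~ @draws_bad R m delta T w -> total_cost m delta T w <= B.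
  by move=> nw; apply: le_trans (total_cost_le m_gt0 delta01 w) _; exact: potential_le.
have regretB (w : @outcome R m T) : ~ @bad R F m delta T w -> regret F m delta T w <= B.
  move=> nw; apply: (@le_trans _ _ (\sum_(t < T) upay (initial_obs w) delta (hist delta w t))).
    by apply: regret_le => // wr; apply: nw; left.
  by apply: potential_le => // wd; apply: nw; right.
have fairE (w : @outcome R m T) : ~ @bad R F m delta T w -> fair_in_every_round F m delta T w.
  by move=> nw; apply: good_fair => // wr; apply: nw; left.
have mfair := @measurable_fair_in_every_round R F m delta T.
split.
- by apply: (probability_setC_ge mfair mbad _ badP) => w; exact: fairE.
- apply: (probability_setC_ge _ mbad _ badP) => [|w nw].
    rewrite (_ : [set w | _] =
        [set w | fair_in_every_round F m delta T w] `&`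
        ([set w | total_cost m delta T w <= bound] `&`
         [set w | regret F m delta T w <= bound])); last first.
      by apply/seteqP; split => [w []|w [? []]].
    apply: measurableI => //; apply: measurableI; rewrite -[X in measurable X]setTI;
      apply: measurable_fun_le => //.
      exact: measurable_total_cost.
    exact: measurable_regret.
  split; first exact: fairE.
    by apply: le_trans B_bound; apply: costB => wd; apply: nw; right.
  by apply: le_trans B_bound; exact: regretB.
(* Only the event on draws enters: its probability cancels the factor [4 * T] of the crude bound and
   leaves [delta * Num.sqrt (logw delta T)]. *)
- apply: (@le_trans _ _ (B + T%:R * (4 * Num.sqrt (logw delta T)) *
      (delta / (4 * T%:R)))%:E).
    apply: (@expectation_le_indic _ _ _ P _ (@draws_bad R m delta T)) => //.
    + exact: measurable_draws_bad.
    + by move=> w; exact: total_cost_ge0.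
    + move=> w; apply: le_trans (total_cost_le m_gt0 delta01 w) _.
      by apply: le_trans (potential_le_all m_gt0 delta01 w) _; rewrite lerDr.
    + exact: draws_bad_le.
  rewrite lee_fin; apply: le_trans Bbound; rewrite lerD2l.
  have -> : T%:R * (4 * Num.sqrt (logw delta T)) * (delta / (4 * T%:R)) =
      delta * Num.sqrt (logw delta T) by field; rewrite gt_eqF.
  by rewrite ler_piMl // ltW.
- apply: (@le_trans _ _ (B + T%:R * delta)%:E).
    apply: (@expectation_le_indic _ _ _ P _ (@bad R F m delta T)) => //.
    + by move=> w; case/andP: (regret_bounds delta F01 w).
    + move=> w; case/andP: (regret_bounds delta F01 w) => _ le_T.
      by apply: le_trans le_T _; rewrite lerDr.
  by rewrite lee_fin [T%:R * _]mulrC lerD2r.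
Qed.
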